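(* There is an algorithm which, given any set $S$ of $n$ points in $\mathbb{R}^2$, computes a dominating set $S'\subseteq S$ of $S$ with $|S'|\le \frac{5}{2}\,|OPT|$, where $OPT$ is a minimum dominating set of $S$, and which runs in $O(n^{20}\log n)$ time.
   Context: For a finite point set $S\subset\mathbb{R}^2$, a dominating set of $S$ is a subset $S'\subseteq S$ such that every point of $S$ lies in at least one disk of radius $1$ centered at a point of $S'$, i.e. every point of $S$ is at Euclidean distance at most $1$ from some point of $S'$. A minimum dominating set is a dominating set of minimum cardinality. *)

(* Defs.v *)
From mathcomp Require Import all_boot all_order all_algebra finmap.
From mathcomp Require Import reals.
Import Order.TTheory GRing.Theory Num.Theory.

Set Implicit Arguments.
Unset Strict Implicit.
Unset Printing Implicit Defensive.

Local Open Scope ring_scope.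

Definition plane (R : realType) : choiceType := (R * R)%type.

Definition edist (R : realType) (p q : plane R) : R :=
  Num.sqrt ((p.1 - q.1) ^+ 2 + (p.2 - q.2) ^+ 2).

Definition dominating_set (R : realType) (S S' : {fset plane R}) : Prop :=
  (S' `<=` S)%fset /\
  forall p, p \in S -> exists2 q, q \in S' & edist p q <= 1.

Definition minimum_dominating_set (R : realType) (S O : {fset plane R}) : Prop :=
  dominating_set S O /\
  forall O', dominating_set S O' -> (#|` O| <= #|` O'|)%N.

(* The model of computation is the uniform-cost real RAM, presented as a
   structured language.  A program is a finite syntactic object that does not
   depend on the input.  Memory cells are of two sorts:
   - word cells, holding integers below a bound W and used for control and for
     addressing;
   - real cells, holding arbitrary real numbers.
   Each sort has scalar variables and one-dimensional arrays; names of variables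
   and arrays are fixed in the program, array indices are computed at run time.
   A word can be converted to a real, but there is no floor: real data can only
   influence words through comparisons. *)

Inductive wop := WAdd | WSub | WMul | WDiv | WMod.
Inductive rop := RAdd | RSub | RMul | RDiv.

Inductive wexp :=
| WConst of nat
| WVar of nat
| WArr of nat & wexp
| WBin of wop & wexp & wexp.

Inductive rexp :=
| RVar of nat
| RArr of nat & wexp
| ROfWord of wexp
| RBin of rop & rexp & rexp
| RSqrt of rexp.

Inductive bexp :=
| BWlt of wexp & wexp
| BWeq of wexp & wexp
| BRle of rexp & rexp
| BNot of bexp
| BAnd of bexp & bexp.

Inductive cmd :=
| CSkip
| CSetW of nat & wexp
| CSetWArr of nat & wexp & wexp
| CSetR of nat & rexp
| CSetRArr of nat & wexp & rexp
| CSeq of cmd & cmd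
| CIf of bexp & cmd & cmd
| CWhile of bexp & cmd.

Record store (R : realType) := Store {
  wvar : nat -> nat;
  warr : nat -> nat -> nat;
  rvar : nat -> R;
  rarr : nat -> nat -> R }.

Definition upd (A : Type) (f : nat -> A) (i : nat) (a : A) : nat -> A :=
  fun j => if j == i then a else f j.

Definition upd2 (A : Type) (f : nat -> nat -> A) (x i : nat) (a : A) :
    nat -> nat -> A :=
  upd f x (upd (f x) i a).

Definition set_wvar (R : realType) (m : store R) x v :=
  Store (upd (wvar m) x v) (warr m) (rvar m) (rarr m).
Definition set_warr (R : realType) (m : store R) x i v :=
  Store (wvar m) (upd2 (warr m) x i v) (rvar m) (rarr m).
Definition set_rvar (R : realType) (m : store R) x (v : R) :=
  Store (wvar m) (warr m) (upd (rvar m) x v) (rarr m).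
Definition set_rarr (R : realType) (m : store R) x i (v : R) :=
  Store (wvar m) (warr m) (rvar m) (upd2 (rarr m) x i v).

(* Word subtraction is truncated at 0, and n %/ 0 = 0, n %% 0 = n. *)
Definition wop_val (o : wop) : nat -> nat -> nat :=
  match o with
  | WAdd => addn | WSub => subn | WMul => muln | WDiv => divn | WMod => modn
  end.

(* As usual in MathComp, x / 0 = 0 and Num.sqrt x = 0 for x < 0. *)
Definition rop_val (R : realType) (o : rop) (x y : R) : R :=
  match o with
  | RAdd => x + y | RSub => x - y | RMul => x * y | RDiv => x / y
  end.

Fixpoint wval (R : realType) (m : store R) (e : wexp) : nat :=
  match e with
  | WConst k => k
  | WVar x => wvar m x
  | WArr x e1 => warr m x (wval m e1)
  | WBin o e1 e2 => wop_val o (wval m e1) (wval m e2)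
  end.

Fixpoint rval (R : realType) (m : store R) (e : rexp) : R :=
  match e with
  | RVar x => rvar m x
  | RArr x e1 => rarr m x (wval m e1)
  | ROfWord e1 => (wval m e1)%:R
  | RBin o e1 e2 => rop_val o (rval m e1) (rval m e2)
  | RSqrt e1 => Num.sqrt (rval m e1)
  end.

Fixpoint bval (R : realType) (m : store R) (b : bexp) : bool :=
  match b with
  | BWlt e1 e2 => (wval m e1 < wval m e2)%N
  | BWeq e1 e2 => wval m e1 == wval m e2
  | BRle e1 e2 => rval m e1 <= rval m e2
  | BNot b1 => ~~ bval m b1
  | BAnd b1 b2 => bval m b1 && bval m b2
  end.

(* [wfit W m e]: no word computed while evaluating e, including intermediate
   results and array indices, reaches W. *)
Fixpoint wfit (R : realType) (W : nat) (m : store R) (e : wexp) : bool :=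
  (wval m e < W)%N &&
  match e with
  | WConst _ | WVar _ => true
  | WArr _ e1 => wfit W m e1
  | WBin _ e1 e2 => wfit W m e1 && wfit W m e2
  end.

Fixpoint rfit (R : realType) (W : nat) (m : store R) (e : rexp) : bool :=
  match e with
  | RVar _ => true
  | RArr _ e1 | ROfWord e1 => wfit W m e1
  | RBin _ e1 e2 => rfit W m e1 && rfit W m e2
  | RSqrt e1 => rfit W m e1
  end.

Fixpoint bfit (R : realType) (W : nat) (m : store R) (b : bexp) : bool :=
  match b with
  | BWlt e1 e2 | BWeq e1 e2 => wfit W m e1 && wfit W m e2
  | BRle e1 e2 => rfit W m e1 && rfit W m e2
  | BNot b1 => bfit W m b1
  | BAnd b1 b2 => bfit W m b1 && bfit W m b2
  end.

(* Unit cost for every memory access, operation and comparison. *)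
Fixpoint wcost (e : wexp) : nat :=
  match e with
  | WConst _ | WVar _ => 1
  | WArr _ e1 => (wcost e1).+1
  | WBin _ e1 e2 => (wcost e1 + wcost e2).+1
  end.

Fixpoint rcost (e : rexp) : nat :=
  match e with
  | RVar _ => 1
  | RArr _ e1 | ROfWord e1 => (wcost e1).+1
  | RBin _ e1 e2 => (rcost e1 + rcost e2).+1
  | RSqrt e1 => (rcost e1).+1
  end.

Fixpoint bcost (b : bexp) : nat :=
  match b with
  | BWlt e1 e2 | BWeq e1 e2 => (wcost e1 + wcost e2).+1
  | BRle e1 e2 => (rcost e1 + rcost e2).+1
  | BNot b1 => (bcost b1).+1
  | BAnd b1 b2 => (bcost b1 + bcost b2).+1
  end.

(* [exec W c m t m']: with words bounded by W, command c started in store m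
   halts in store m' after t elementary steps.  A word overflow blocks the
   execution, so a derivation certifies that none occurs. *)
Inductive exec (R : realType) (W : nat) :
    cmd -> store R -> nat -> store R -> Prop :=
| ExecSkip m : exec W CSkip m 1 m
| ExecSetW m x e :
    wfit W m e ->
    exec W (CSetW x e) m (wcost e).+1 (set_wvar m x (wval m e))
| ExecSetWArr m x i e :
    wfit W m i -> wfit W m e ->
    exec W (CSetWArr x i e) m (wcost i + wcost e).+1
      (set_warr m x (wval m i) (wval m e))
| ExecSetR m x e :
    rfit W m e ->
    exec W (CSetR x e) m (rcost e).+1 (set_rvar m x (rval m e))
| ExecSetRArr m x i e :
    wfit W m i -> rfit W m e ->
    exec W (CSetRArr x i e) m (wcost i + rcost e).+1
      (set_rarr m x (wval m i) (rval m e))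
| ExecSeq c1 c2 m1 t1 m2 t2 m3 :
    exec W c1 m1 t1 m2 -> exec W c2 m2 t2 m3 ->
    exec W (CSeq c1 c2) m1 (t1 + t2)%N m3
| ExecIfTrue b c1 c2 m t m' :
    bfit W m b -> bval m b -> exec W c1 m t m' ->
    exec W (CIf b c1 c2) m ((bcost b).+1 + t)%N m'
| ExecIfFalse b c1 c2 m t m' :
    bfit W m b -> ~~ bval m b -> exec W c2 m t m' ->
    exec W (CIf b c1 c2) m ((bcost b).+1 + t)%N m'
| ExecWhileFalse b c m :
    bfit W m b -> ~~ bval m b ->
    exec W (CWhile b c) m (bcost b).+1 m
| ExecWhileTrue b c m1 t1 m2 t2 m3 :
    bfit W m1 b -> bval m1 b ->
    exec W c m1 t1 m2 -> exec W (CWhile b c) m2 t2 m3 ->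
    exec W (CWhile b c) m1 ((bcost b).+1 + t1 + t2)%N m3.

(* Words of at most k * log2 (n + 2) bits. *)
Definition word_bound (k n : nat) : nat := (n.+2 ^ k)%N.

(* Word variable 0 holds the number of points, real arrays 0 and 1 their
   abscissas and ordinates; every other cell is 0. *)
Definition input_store (R : realType) (s : seq (plane R)) : store R :=
  Store (upd (fun=> 0%N) 0%N (size s))
        (fun _ _ => 0%N)
        (fun=> 0)
        (fun a i => match a with
                    | 0%N => (nth (0, 0) s i).1
                    | 1%N => (nth (0, 0) s i).2
                    | _ => 0
                    end).

(* On output, word variable 0 holds the cardinality of the computed subset and
   word array 0 lists, without repetition, the positions of its elements in the
   input listing s. *)
Definition outputs (R : realType) (s : seq (plane R)) (m : store R)
    (S' : {fset plane R}) : Prop :=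
  let idx := [seq warr m 0 i | i <- iota 0 (wvar m 0)] in
  [/\ all (fun i => (i < size s)%N) idx, uniq idx &
      S' = [fset nth (0, 0) s i | i in idx]%fset].

(* Main.v *)
Require Import Defs.
From mathcomp Require Import all_boot all_order all_algebra finmap.
From mathcomp Require Import boolp classical_sets reals topology normedtype sequences landau exp.
From mathcomp Require Import zify lra.
Import Order.TTheory GRing.Theory Num.Theory.
Import numFieldNormedType.Exports.

Set Implicit Arguments.
Unset Strict Implicit.
Unset Printing Implicit Defensive.

Local Open Scope ring_scope.

(* Let the height of a point be the length of the longest chain of points below
   it whose ordinates increase by at least 2/3 at each step, and let a row
   consist of the points of equal height.  The ordinates in a row differ by less
   than 2/3, and those of points four rows apart by more than 2; this replaces a
   horizontal grid, which the real RAM cannot compute without a floor function.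
   Pairing consecutive rows into strips, in the two possible ways, a unit disk
   meets at most five strips in all.  If every strip is dominated optimally, the
   better of the two pairings thus yields at most 5/2 times the optimum.

   A strip is dominated optimally by a sweep in the direction of the abscissas.
   In an optimal solution at most 12 chosen points have their abscissa in a
   given interval of length 2: the points they dominate fit in 6 x 2 cells of
   diameter at most 1, and one representative of each cell would do as well.
   So it is enough to remember the last 12 chosen points, which leaves n^12
   states and the overall time bound O(n^17). *)

(** * Rows and strips *)

Section Geometry.
Variables (R : realType) (n : nat) (X Y : nat -> R).

Definition within1 i j : bool := (X i - X j) ^+ 2 + (Y i - Y j) ^+ 2 <= 1.

Lemma within1C i j : within1 i j = within1 j i.
Proof. by rewrite /within1 -[X i - _]opprB -[Y i - _]opprB !sqrrN. Qed.

Lemma within1xx i : within1 i i.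
Proof. by rewrite /within1 !subrr expr0n addr0 ler01. Qed.

Lemma within1_x i j : within1 i j -> X i - 1 <= X j <= X i + 1.
Proof.
rewrite /within1 => h; have h2 := sqr_ge0 (Y i - Y j).
by apply/andP; split; nra.
Qed.

Lemma within1_y i j : within1 i j -> Y i - 1 <= Y j <= Y i + 1.
Proof.
rewrite /within1 => h; have h2 := sqr_ge0 (X i - X j).
by apply/andP; split; nra.
Qed.

(** This fixes the constant 2/3: a square of side 2/3 has squared diagonal 8/9, below 1, while three
    steps of 2/3 make up the diameter 2 of a unit disk. *)
Lemma within1_box i j :
  - (2 / 3) <= X i - X j <= 2 / 3 -> - (2 / 3) <= Y i - Y j <= 2 / 3 -> within1 i j.
Proof.
rewrite /within1; set a := X i - X j; set b := Y i - Y j => /andP[a1 a2] /andP[b1 b2].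
have ha : a ^+ 2 <= 4 / 9 by nra.
have hb : b ^+ 2 <= 4 / 9 by nra.
lra.
Qed.

(** The points of height at least [r]. *)
Fixpoint level (r i : nat) : bool :=
  if r is r'.+1 then
    has (fun j => level r' j && (Y j + 2 / 3 <= Y i)) (iota 0 n)
  else true.

Lemma levelP r i :
  reflect (exists2 j, (j < n)%N & level r j && (Y j + 2 / 3 <= Y i)) (level r.+1 i).
Proof.
by apply: (iffP hasP) => -[j jn h]; exists j => //; move: jn; rewrite mem_iota.
Qed.

Lemma levelS r i : level r.+1 i -> level r i.
Proof.
elim: r i => [//|r IH] i /levelP[j jn /andP[lj ji]].
by apply/levelP; exists j => //; rewrite IH.
Qed.

Lemma level_le r r' i : (r <= r')%N -> level r' i -> level r i.
Proof. by move=> /subnK <-; elim: (r' - r)%N => // d IH /levelS. Qed.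

(** A step down the chain leads to a point [j] that is strictly below [i] but not below itself, so
    the set of strictly lower points shrinks at every step. Hence heights stay below the number of
    points. *)
Lemma level_count r i :
  level r i -> (r <= count (fun j => (Y j < Y i)%R) (iota 0 n))%N.
Proof.
elim: r i => [//|r IH] i /levelP[j jn /andP[/IH lj ji]].
apply: leq_ltn_trans lj _.
rewrite -!size_filter.
have jF : j \notin [seq k <- iota 0 n | (Y k < Y j)%R].
  by rewrite mem_filter ltxx.
rewrite -[X in (X <= _)%N]/(size (j :: [seq k <- iota 0 n | (Y k < Y j)%R])).
apply: uniq_leq_size; first by rewrite /= jF filter_uniq ?iota_uniq.
have h : Y j < Y i by apply: lt_le_trans ji; lra.
move=> k; rewrite inE !mem_filter => /orP[/eqP->|/andP[kj ->]].
  by rewrite h mem_iota.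
by rewrite (lt_trans kj h).
Qed.

Lemma level_n i : (i < n)%N -> ~~ level n i.
Proof.
move=> lin; apply/negP => /level_count; apply/negP; rewrite -ltnNge.
rewrite -[X in (_ < X)%N](size_iota 0 n) -(count_predC (fun j => (Y j < Y i)%R)).
rewrite -[X in (X < _)%N]addn0 ltn_add2l -has_count.
by apply/hasP; exists i => /=; rewrite ?mem_iota ?ltxx.
Qed.

(** The heights enter only through [rowP], so that the results apply to whatever heights the program
    leaves in its array. *)
Variable row : nat -> nat.
Hypothesis rowP : forall i k, (i < n)%N -> (k <= n)%N -> (k <= row i)%N = level k i.

Lemma row_lt i : (i < n)%N -> (row i < n)%N.
Proof.
by move=> lin; rewrite ltnNge (rowP lin (leqnn n)) level_n.
Qed.

(** Otherwise a chain ending in [j] could be prolonged to [i], which would put [i] in a higher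
    row. *)
Lemma row_same i j : (i < n)%N -> (j < n)%N -> row i = row j ->
  Y i < Y j + 2 / 3.
Proof.
move=> lin ljn e; rewrite ltNge; apply/negP => h.
have lj : (row j <= n)%N by rewrite ltnW // row_lt.
have := @rowP i (row j).+1 lin (row_lt ljn); rewrite e ltnn => /esym/negP; apply.
by apply/levelP; exists j => //; rewrite -rowP // leqnn h.
Qed.

(** Four steps down from [i] lead to a point [d] of height at least [row j] with [Y d + 8/3 <= Y i].
    Moreover [Y j < Y d + 2/3], since otherwise [j] would be higher than its row. *)
Lemma row_far i j : (i < n)%N -> (j < n)%N -> (row j + 4 <= row i)%N ->
  Y j + 2 < Y i.
Proof.
move=> lin ljn h.
have : level (row j + 4) i.
  by rewrite -rowP // (leq_trans h) // ltnW // row_lt.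
rewrite addnC => /levelP[a _ /andP[/levelP[b _ /andP[/levelP[c _ /andP[]]]]]].
move=> /levelP[d dn /andP[ld dc]] cb ba ai.
suff : Y j < Y d + 2 / 3 by move: dc cb ba ai; lra.
rewrite ltNge; apply/negP => hd.
have := @rowP j (row j).+1 ljn (row_lt ljn); rewrite ltnn => /esym/negP; apply.
by apply/levelP; exists d; rewrite // ld.
Qed.

(* The strips [G] of equal parity partition the points. *)
Definition strip (G i : nat) : bool := ((row i + G %% 2) %/ 2 == G %/ 2)%N.

(** The points of [D] may lie outside the strip. Thus those points of a dominating set whose disks
    touch the strip dominate it. *)
Definition dominates G (D : {set 'I_n}) : bool :=
  [forall t : 'I_n, strip G t ==> [exists d in D, within1 d t]].

Lemma dominates_setT G : dominates G finset.setT.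
Proof.
apply/forallP => t; apply/implyP => _; apply/existsP; exists t.
by rewrite inE within1xx.
Qed.

Definition opt_set G : {set 'I_n} := [arg min_(D < finset.setT | dominates G D) #|D|].
Definition opt G : nat := #|opt_set G|.

Lemma opt_setP G : dominates G (opt_set G).
Proof. by rewrite /opt_set; case: arg_minnP => //; apply: dominates_setT. Qed.

Lemma opt_min G D : dominates G D -> (opt G <= #|D|)%N.
Proof.
rewrite /opt /opt_set; case: arg_minnP => [|D0 _]; first exact: dominates_setT.
by apply.
Qed.

(* Fewer points suffice: one representative for each nonempty cell of a grid of
   6 columns and 2 rows, all cells of diameter at most 1. *)
Lemma opt_set_window G u :
  (#|[set d in opt_set G | (u - 1 <= X d <= u + 1)%R]| <= 12)%N.
Proof.
set D := opt_set G; set B := [set d in D | _].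
rewrite leqNgt; apply/negP => B12.
(* The parity [k.2] tells the two rows of the strip apart. Points dominated by [B] have abscissas
   within 2 of [u], a range covered by six columns of width 2/3. *)
pose cell (k : 'I_6 * bool) (t : 'I_n) := [&& strip G t,
  odd (row t + G %% 2) == k.2,
  (u - 2 + (k.1 : nat)%:R * (2 / 3) <= X t)%R &
  (X t <= u - 2 + (k.1 : nat).+1%:R * (2 / 3))%R].
pose rep k := [pick t | cell k t].
pose C := [set t | Some t \in [set rep k | k : 'I_6 * bool]].
have C12 : (#|C| <= 12)%N.
  have -> : 12%N = #|{: 'I_6 * bool}| by rewrite card_prod card_ord card_bool.
  apply: leq_trans (leq_imset_card rep _).
  rewrite -(card_imset C (@Some_inj _)); apply: subset_leq_card.
  by apply/fintype.subsetP => _ /imsetP[t tC ->]; rewrite inE in tC.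
(* Exchanging [B] for the representatives keeps the strip dominated, so more than 12 points in [B]
   would contradict minimality. *)
have DC : dominates G (D :\: B :|: C).
  apply/forallP => t; apply/implyP => tG.
  have /forallP/(_ t)/implyP/(_ tG)/existsP[d /andP[dD dt]] := opt_setP G.
  have [dB|dB] := boolP (d \in B); last first.
    by apply/existsP; exists d; rewrite !inE; rewrite inE in dB; rewrite dB dt dD.
  have hX : u - 2 <= X t <= u + 2.
    move: dB; rewrite inE => /andP[_ /andP[]]; move/within1_x: dt => /andP[].
    by move=> *; apply/andP; split; lra.
  have [k kt] : exists k : 'I_6 * bool, cell k t.
    have [k hk] : exists k : 'I_6, (u - 2 + (k : nat)%:R * (2 / 3) <= X t)%R &&
      (X t <= u - 2 + (k : nat).+1%:R * (2 / 3))%R.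
      case/andP: hX => h1 h2.
      have [h|h] := lerP (X t) (u - 2 + 2 / 3).
        by exists (inord 0); rewrite inordK //; apply/andP; split; lra.
      have [h'|h'] := lerP (X t) (u - 2 + 4 / 3).
        by exists (inord 1); rewrite inordK //; apply/andP; split; lra.
      have [h''|h''] := lerP (X t) u.
        by exists (inord 2); rewrite inordK //; apply/andP; split; lra.
      have [h3|h3] := lerP (X t) (u + 2 / 3).
        by exists (inord 3); rewrite inordK //; apply/andP; split; lra.
      have [h4|h4] := lerP (X t) (u + 4 / 3).
        by exists (inord 4); rewrite inordK //; apply/andP; split; lra.
      by exists (inord 5); rewrite inordK //; apply/andP; split; lra.
    by exists (k, odd (row t + G %% 2)); rewrite /cell tG eqxx hk.
  have [t' rt'] : exists t', rep k = Some t'.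
    by rewrite /rep; case: pickP => [t' _|/(_ t)]; [exists t'|rewrite kt].
  have kt' : cell k t' by move: rt'; rewrite /rep; case: pickP => // ? ? [<-].
  apply/existsP; exists t'; apply/andP; split.
    by rewrite !inE; apply/orP; right; rewrite -rt'; apply: imset_f.
  have e : row t' = row t.
    move: kt kt' => /and4P[/eqP s1 /eqP p1 _ _] /and4P[/eqP s2 /eqP p2 _ _].
    move: p1; rewrite -p2 => p1.
    by move: s1 s2 p1; set g := (G %% 2)%N; lia.
  have := row_same (ltn_ord t) (ltn_ord t') (esym e).
  have := row_same (ltn_ord t') (ltn_ord t) e.
  move: kt kt' => /and4P[_ _ + +] /and4P[_ _ + +].
  have -> : (k.1 : nat).+1%:R = (k.1 : nat)%:R + 1 :> R by rewrite natr1.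
  by set a := (k.1 : nat)%:R => *; apply: within1_box; apply/andP; split; lra.
have := opt_min DC; apply/negP; rewrite -ltnNge.
apply: leq_ltn_trans (leq_card_setU _ _) _.
have BD : B \subset D by apply/fintype.subsetP => d; rewrite inE => /andP[].
rewrite cardsD (finset.setIidPr BD) /opt -/D.
have BD' := subset_leq_card BD.
apply: (@leq_ltn_trans (#|D| - #|B| + 12)); first by rewrite leq_add2l.
rewrite -ltnS -addSn in B12 *.
move: #|B| #|D| BD' B12 => b d; lia.
Qed.

(** Double counting: the points of [D] that touch a strip dominate it, and each point of [D] touches
    at most five strips. *)
Lemma sum_opt_le (D : {set 'I_n}) :
  (forall t : 'I_n, exists2 d, d \in D & within1 d t) ->
  (\sum_(0 <= G < n.*2.+2) opt G <= 5 * #|D|)%N.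
Proof.
move=> hD.
pose touch G (d : 'I_n) := [exists t : 'I_n, strip G t && within1 d t].
have hG G : (opt G <= \sum_(d in D) touch G d)%N.
  have -> : (\sum_(d in D) touch G d = #|[set d in D | touch G d]|)%N.
    rewrite -sum1_card -big_mkcondr /=; apply: eq_bigl => d.
    by rewrite inE.
  apply: opt_min.
  apply/forallP => t; apply/implyP => tG; have [d dD dt] := hD t.
  apply/existsP; exists d; rewrite inE dt dD !andbT /=.
  by apply/existsP; exists t; rewrite tG.
apply: leq_trans (leq_sum _ (fun G _ => hG G)) _.
rewrite exchange_big /= mulnC -sum_nat_const; apply: leq_sum => d dD.
(* [r] is the lowest row met by the disk around [d]; [row_far] excludes the rows from [r + 4] on. *)
have [r hr] : exists r, forall t : 'I_n, within1 d t -> (r <= row t < r + 4)%N.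
  have [t0 /andP[_ t0P]] : exists t0 : 'I_n, true && within1 d t0 by exists d; exact: within1xx.
  case: (@arg_minnP _ t0 (within1 d) (fun t => row t) t0P) => t1 t1P tmin.
  exists (row t1) => t td; rewrite tmin //= ltnNge; apply/negP => h.
  have := row_far (ltn_ord t) (ltn_ord t1) h.
  move/within1_y: td => /andP[_]; move/within1_y: t1P => /andP[+ _]; lra.
have {}hr G : touch G d -> ((r + G %% 2) %/ 2 <= G %/ 2 <= (r + 3 + G %% 2) %/ 2)%N.
  move=> /existsP[t /andP[/eqP <- /hr]]; lia.
pose s := [seq G <- index_iota 0 n.*2.+2 | touch G d].
have -> : (\sum_(0 <= G < n.*2.+2) touch G d = size s)%N.
  rewrite -big_mkcond /= sum1_count size_filter //.
have us : uniq s by rewrite filter_uniq ?iota_uniq.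
(* Four consecutive rows meet two strips of one pairing and three of the other; the parity of [r]
   decides which. *)
have sub : {subset s <= if odd r then [:: r.-1; r.+1; r.+2; r.+3; r + 4]%N
                        else [:: r; r.+1; r.+2; r.+3; r + 5]%N}.
  move=> G; rewrite mem_filter => /andP[/hr + _].
  by case: ifP => ?; rewrite !inE; lia.
by have := uniq_leq_size us sub; case: ifP.
Qed.

End Geometry.

(** * Sweeping a strip *)

Section Sweep.
Variables (R : realType) (n : nat) (X Y : nat -> R) (row : nat -> nat).

(* A state of the sweep lists the last 12 chosen points, latest first, as the
   digits of a number in base [n.+1]; the digit [i.+1] stands for point [i] and
   the digit 0 for no point. *)
Definition digit (k c : nat) : nat := (c %/ n.+1 ^ k %% n.+1)%N.
Definition push (c q : nat) : nat := (c %% n.+1 ^ 11 * n.+1 + q)%N.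
Definition states : nat := locked (n.+1 ^ 12)%N.
Definition encode (w : seq nat) : nat := foldl push 0%N w.

(** The digit 0 acts as an extreme on either side: as the latest choice it lies left of everything,
    as the next choice right of everything. *)
Definition bad (G c q t : nat) : bool :=
  [&& strip row G t,
      (c %% n.+1 == 0)%N || (X (c %% n.+1 - 1)%N <= X t + 1),
      (q == 0)%N || ~~ (X (q - 1)%N <= X t + 1) &
      ~~ has (fun k => (digit k c != 0)%N && within1 X Y (digit k c - 1)%N t) (iota 0 12)].

(* The points of the strip that can no longer be reached once [q] is chosen
   next, and could be reached before, are dominated by the state [c]; [q = 0]
   closes the sweep. *)
Definition allowed (G c q : nat) : bool :=
  all (fun t => ~~ bad G c q t) (iota 0 n).

Definition sweep (G : nat) (w : seq nat) : Prop :=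
  forall i, (i < size w)%N ->
    (0 < nth 0%N w i <= n)%N /\ allowed G (encode (take i w)) (nth 0%N w i).

Lemma states_gt0 : (0 < states)%N.
Proof. by rewrite /states -lock expn_gt0. Qed.

Lemma push_lt c q : (q <= n)%N -> (push c q < states)%N.
Proof.
move=> qn; rewrite /states -lock /push (expnSr _ 11).
have h : (c %% n.+1 ^ 11 < n.+1 ^ 11)%N by rewrite ltn_mod expn_gt0.
apply: leq_trans (leq_mul h (leqnn n.+1)).
by rewrite mulSn [(n.+1 + _)%N]addnC ltn_add2l.
Qed.

Lemma push_modn c q : (q <= n)%N -> (push c q %% n.+1 = q)%N.
Proof. by move=> qn; rewrite /push modnMDl modn_small. Qed.

Lemma push_digit0 c q : (q <= n)%N -> digit 0 (push c q) = q.
Proof. by move=> qn; rewrite /digit expn0 divn1 push_modn. Qed.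

(** Only the oldest digit is dropped: reduction modulo [n.+1 ^ 11] leaves the digits below position
    11 alone. *)
Lemma push_digitS c q k : (q <= n)%N -> (k < 11)%N ->
  digit k.+1 (push c q) = digit k c.
Proof.
move=> qn k11; rewrite /digit /push (expnS _ k) divnMA divnMDl // (@divn_small q) //.
have e : (n.+1 ^ 11 = n.+1 ^ (10 - k) * n.+1 * n.+1 ^ k)%N.
  by rewrite -expnSr -expnD; congr (_ ^ _)%N; lia.
have h a b : ((a * n.+1 ^ 11 + b) %/ n.+1 ^ k %% n.+1 = b %/ n.+1 ^ k %% n.+1)%N.
  by rewrite e !mulnA divnMDl ?expn_gt0 // modnMDl.
by rewrite addn0 [in RHS](divn_eq c (n.+1 ^ 11)) h.
Qed.

Lemma encode_rcons w q : encode (rcons w q) = push (encode w) q.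
Proof. by rewrite /encode foldl_rcons. Qed.

Lemma encode_lt w : all (fun q => q <= n)%N w -> (encode w < states)%N.
Proof.
elim/last_ind: w => [|w q _]; first by rewrite states_gt0.
by rewrite all_rcons encode_rcons => /andP[qn _]; rewrite push_lt.
Qed.

(** For short lists the default 0 of [nth] agrees with the digit 0 for no point. *)
Lemma encode_digit w k : all (fun q => q <= n)%N w -> (k < 12)%N ->
  digit k (encode w) = nth 0%N (rev w) k.
Proof.
elim/last_ind: w k => [|w q IH] k; first by rewrite /digit div0n mod0n nth_nil.
rewrite all_rcons encode_rcons rev_rcons => /andP[qn wn].
by case: k => [|k] k12; rewrite ?push_digit0 ?push_digitS //= IH // ltnW.
Qed.

Lemma encode_modn w : all (fun q => q <= n)%N w ->
  (encode w %% n.+1)%N = last 0%N w.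
Proof.
elim/last_ind: w => [|w q _]; first by rewrite mod0n.
by rewrite all_rcons encode_rcons last_rcons => /andP[qn _]; rewrite push_modn.
Qed.

Lemma sweep_le G w : sweep G w -> all (fun q => q <= n)%N w.
Proof. by move=> h; apply/(all_nthP 0%N) => i /h[/andP[]]. Qed.

Lemma sweep_rcons G w q : sweep G w -> (0 < q <= n)%N -> allowed G (encode w) q ->
  sweep G (rcons w q).
Proof.
move=> hw hq ha i; rewrite size_rcons ltnS leq_eqVlt => /orP[/eqP->|iw].
  by rewrite nth_rcons ltnn eqxx -cats1 take_size_cat.
have -> : take i (rcons w q) = take i w by rewrite -cats1 takel_cat 1?ltnW.
by rewrite nth_rcons iw; exact: hw.
Qed.

Lemma allowedP G c q t : allowed G c q -> (t < n)%N -> strip row G t ->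
  (c %% n.+1 == 0)%N || (X (c %% n.+1 - 1)%N <= X t + 1) ->
  (q == 0)%N || ~~ (X (q - 1)%N <= X t + 1) ->
  exists k, [/\ (k < 12)%N, digit k c != 0%N & within1 X Y (digit k c - 1)%N t].
Proof.
move=> /allP/(_ t); rewrite mem_iota => h /h nb tG hl hq.
move: nb; rewrite /bad tG hl hq negbK => /hasP[k].
by rewrite mem_iota => k12 /andP[]; exists k.
Qed.

(* The choices need not be sorted by abscissa: some transition passes
   [X t + 1]. *)
Lemma sweep_sound G w t : sweep G w -> allowed G (encode w) 0 -> (t < n)%N ->
  strip row G t -> exists2 q, q \in w & within1 X Y (q - 1)%N t.
Proof.
move=> hw h0 tn tG; have wn := sweep_le hw.
(* An allowed transition that passes [X t + 1] guarantees that a remembered point dominates [t]. *)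
have fin v q : {subset v <= w} -> allowed G (encode v) q ->
    (last 0%N v == 0)%N || (X (last 0%N v - 1)%N <= X t + 1) ->
    (q == 0)%N || ~~ (X (q - 1)%N <= X t + 1) ->
    exists2 q, q \in w & within1 X Y (q - 1)%N t.
  move=> vw ha hl hq.
  have vn : all (fun q => q <= n)%N v by apply/allP => x /vw; apply: (allP wn).
  rewrite -(encode_modn vn) in hl.
  have [k [k12 dk nk]] := allowedP ha tn tG hl hq.
  rewrite encode_digit // in dk nk.
  exists (nth 0%N (rev v) k) => //; apply: vw; rewrite -mem_rev mem_nth //.
  by rewrite ltnNge; apply/negP => h; rewrite nth_default in dk.
(* As long as no transition has passed [X t + 1], the latest choice is not beyond it; closing the
   sweep passes it at the latest. *)
have passed i : (i <= size w)%N ->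
    (exists2 q, q \in w & within1 X Y (q - 1)%N t) \/
    (last 0%N (take i w) == 0)%N || (X (last 0%N (take i w) - 1)%N <= X t + 1).
  elim: i => [|i IH] iw; first by rewrite take0; right.
  have [|hl] := IH (ltnW iw); first by left.
  rewrite (take_nth 0%N) // last_rcons.
  have [hq|hq] := boolP (X (nth 0%N w i - 1)%N <= X t + 1); first by right; rewrite orbT.
  left; apply: (fin (take i w) (nth 0%N w i)) => //; last by rewrite hq orbT.
    exact: mem_take.
  by have [] := hw i iw.
have [//|] := passed _ (leqnn _); rewrite take_size => hl.
exact: (fin w 0%N).
Qed.

Hypothesis rowP : forall i k, (i < n)%N -> (k <= n)%N -> (k <= row i)%N = level n Y k i.

(** The sweep takes an optimal set by increasing abscissa. When it passes [X t + 1], all choices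
    from a dominator of [t] onwards have abscissas within 1 of [X t]. By [opt_set_window] there are
    at most 12 of them, so the dominator is still remembered. *)
Lemma sweep_complete G : exists w,
  [/\ size w = opt n X Y row G, sweep G w & allowed G (encode w) 0].
Proof.
pose D := opt_set n X Y row G.
pose le := fun d e : 'I_n => X d <= X e.
pose ds := sort le (enum D).
have sds : size ds = opt n X Y row G by rewrite size_sort -cardE.
have memds d : (d \in ds) = (d \in D) by rewrite mem_sort mem_enum.
have uds : uniq ds by rewrite sort_uniq enum_uniq.
have sorted_ds : sorted le ds by apply: sort_sorted => d e; exact: le_total.
pose f := fun d : 'I_n => d.+1.
pose w := map f ds.
have sw : size w = size ds by rewrite size_map.
have wn : all (fun q => q <= n)%N w.
  by apply/allP => _ /mapP[d _ ->]; rewrite /f ltn_ord.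
(* The case [i = size w] is the closing transition: [nth] then returns its default 0. *)
have key i t : (i <= size w)%N -> (t < n)%N ->
    ~~ bad G (encode (take i w)) (nth 0%N w i) t.
  move=> iw tn.
  have twn : all (fun q => q <= n)%N (take i w).
    by apply/allP => x /mem_take; apply: (allP wn).
  apply/negP => /and4P[tG hl hq /negP]; apply.
  have /forallP/(_ (Ordinal tn))/implyP/(_ tG)/existsP[d /andP[dD dt]] :=
    opt_setP n X Y row G.
  rewrite -/D -memds in dD; set j := index d ds.
  have jw : (j < size ds)%N by rewrite index_mem.
  have dj : nth d ds j = d by rewrite nth_index.
  have mono a b : (a <= b)%N -> (b < size ds)%N -> X (nth d ds a) <= X (nth d ds b).
    move=> ab bs; apply: (sorted_leq_nth _ _ d sorted_ds) => //.
    - by move=> x y z; exact: le_trans.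
    - by move=> x; rewrite /le.
    - by rewrite inE (leq_ltn_trans ab).
  have /andP[dt1 dt2] := within1_x dt; rewrite /= in dt1 dt2.
  (* The dominator is not beyond [X t + 1], hence it precedes the choice that passes this bound. *)
  have ji : (j < i)%N.
    rewrite ltnNge; apply/negP => ij.
    have iw' : (i < size ds)%N := leq_ltn_trans ij jw.
    move: hq; rewrite (nth_map d) //= subn1 /= => /negP; apply.
    by have := mono _ _ ij jw; rewrite dj; move: dt1; lra.
  have i_gt0 : (0 < i)%N by case: (i) ji.
  have i1w : (i.-1 < size ds)%N by rewrite prednK -?sw.
  have hX : X (nth d ds i.-1) <= X t + 1.
    move: hl; rewrite encode_modn //.
    have -> : last 0%N (take i w) = nth 0%N w i.-1.
      by rewrite -nth_last nth_take size_takel // prednK.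
    by rewrite (nth_map d) //= subn1.
  have i12 : (i - j <= 12)%N.
    have := opt_set_window X rowP G (X t); rewrite -/D; apply: leq_trans.
    have us : uniq (take (i - j) (drop j ds)) by rewrite take_uniq // drop_uniq.
    have ss : size (take (i - j) (drop j ds)) = (i - j)%N.
      by rewrite size_takel // size_drop leq_sub2r // -sw.
    rewrite -ss cardE; apply: uniq_leq_size us _ => e /(nthP d)[k].
    rewrite ss => ks; rewrite nth_take // nth_drop => <-; rewrite mem_enum.
    have jki : (j + k <= i.-1)%N by rewrite -ltnS prednK // -ltn_subRL.
    have jks := leq_ltn_trans jki i1w.
    rewrite inE -memds mem_nth //=; apply/andP; split.
      by have := mono _ _ (leq_addr k j) jks; rewrite dj; move: dt2; lra.
    exact: le_trans (mono _ _ jki i1w) hX.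
  have kij : (i.-1 - j < 12)%N by clear - i12 ji; lia.
  apply/hasP; exists (i.-1 - j)%N; first by rewrite mem_iota.
  rewrite encode_digit //.
  have -> : nth 0%N (rev (take i w)) (i.-1 - j) = d.+1.
    rewrite nth_rev size_takel //; last by clear - ji; lia.
    have -> : (i - (i.-1 - j).+1 = j)%N by clear - ji; lia.
    by rewrite nth_take // (nth_map d) // dj.
  by rewrite subn1.
exists w; split; first by rewrite sw.
  move=> i iw; split.
    have hi : nth 0%N w i \in w by rewrite mem_nth.
    rewrite (allP wn _ hi) andbT; by case/mapP: hi => d _ ->.
  by apply/allP => t; rewrite mem_iota => tn; apply: key => //; rewrite ltnW.
apply/allP => t; rewrite mem_iota => tn.
by have := key (size w) t (leqnn _) tn; rewrite take_size nth_default.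
Qed.

(* [P m c] is 0 when no sweep of length [m] ends in the state [c], and
   otherwise the successor of a possible previous state. *)
Definition table (G : nat) (P : nat -> nat -> nat) : Prop :=
  (forall c, (c < states)%N -> P 0%N c != 0%N -> c = 0%N) /\
  forall m c, (m <= n)%N -> (c < states)%N -> P m.+1 c != 0%N ->
    exists q, [/\ (0 < q <= n)%N, ((P m.+1 c).-1 < states)%N,
      P m (P m.+1 c).-1 != 0%N, allowed G (P m.+1 c).-1 q &
      c = push (P m.+1 c).-1 q].

(** Only predecessors are stored; the choice that led to a state is recovered as its last digit. [K]
    stands for what the traceback establishes about each choice. *)
Fixpoint traced (P : nat -> nat -> nat) (K : nat -> Prop) (m c : nat) : Prop :=
  if m is m'.+1 then K (c %% n.+1)%N /\ traced P K m' (P m c).-1 else True.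

(** Each nonzero entry stands for one allowed transition, so following the predecessors down to
    layer 0 builds the sweep from its end. *)
Lemma table_sweep G P K m c : table G P -> (m <= n.+1)%N -> (c < states)%N ->
  P m c != 0%N -> traced P K m c ->
  exists w, [/\ size w = m, sweep G w, encode w = c & forall q, q \in w -> K q].
Proof.
move=> [t0 tS]; elim: m c => [|m IH] c mn cM Pc.
  by move=> _; exists [::]; split=> //; rewrite (t0 c).
move=> [Kc trc]; have [q [qn c'M Pc' ha cE]] := tS m c mn cM Pc.
have [w [sw hw ew Kw]] := IH _ (ltnW mn) c'M Pc' trc.
exists (rcons w q); split.
- by rewrite size_rcons sw.
- by apply: sweep_rcons => //; rewrite ew.
- by rewrite encode_rcons ew.
- move=> x; rewrite mem_rcons inE => /orP[/eqP->|]; last exact: Kw.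
  by move: Kc; rewrite {1}cE push_modn //; case/andP: qn.
Qed.

End Sweep.

(** * Structured programs and their running time *)

(** The only loops are counting loops, for which a time bound can be read off the syntax. Real cells
    are never assigned. *)
Inductive prog :=
| PSkip
| PSetW of nat & wexp
| PSetA of nat & wexp & wexp
| PSeq of prog & prog
| PIf of bexp & prog & prog
| PFor of nat & wexp & prog.

Fixpoint compile (p : prog) : cmd :=
  match p with
  | PSkip => CSkip
  | PSetW x e => CSetW x e
  | PSetA a i e => CSetWArr a i e
  | PSeq p1 p2 => CSeq (compile p1) (compile p2)
  | PIf b p1 p2 => CIf b (compile p1) (compile p2)
  | PFor x hi p1 =>
      CSeq (CSetW x (WConst 0))
        (CWhile (BWlt (WVar x) hi)
          (CSeq (compile p1) (CSetW x (WBin WAdd (WVar x) (WConst 1)))))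
  end.

Section Degrees.
Local Open Scope nat_scope.
(* On inputs of size [n], word variable [x] stays below [n.+2 ^ dvar x], and so
   do the cells of word array [a] below [n.+2 ^ darr a]. *)
Variables dvar darr : nat -> nat.

(** A constant [c] gets degree [c] because [c < n.+2 ^ c]. A sum gains one degree because
    [2 <= n.+2]. Differences, quotients and remainders never exceed the first operand. *)
Fixpoint wdeg (e : wexp) : nat :=
  match e with
  | WConst c => c
  | WVar x => dvar x
  | WArr a _ => darr a
  | WBin WAdd e1 e2 => (maxn (wdeg e1) (wdeg e2)).+1
  | WBin WMul e1 e2 => wdeg e1 + wdeg e2
  | WBin _ e1 _ => wdeg e1
  end.

(** [wfit] inspects every subexpression, array indices included, hence the maximum over all of
    them. *)
Fixpoint wmax (e : wexp) : nat :=
  maxn (wdeg e)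
    match e with
    | WConst _ | WVar _ => 0
    | WArr _ e1 => wmax e1
    | WBin _ e1 e2 => maxn (wmax e1) (wmax e2)
    end.

Fixpoint rmax (e : rexp) : nat :=
  match e with
  | RVar _ => 0
  | RArr _ e1 | ROfWord e1 => wmax e1
  | RBin _ e1 e2 => maxn (rmax e1) (rmax e2)
  | RSqrt e1 => rmax e1
  end.

Fixpoint bmax (b : bexp) : nat :=
  match b with
  | BWlt e1 e2 | BWeq e1 e2 => maxn (wmax e1) (wmax e2)
  | BRle e1 e2 => maxn (rmax e1) (rmax e2)
  | BNot b1 => bmax b1
  | BAnd b1 b2 => maxn (bmax b1) (bmax b2)
  end.

(** An upper bound: both branches of a conditional are charged, and a loop is charged as many rounds
    as its counter has admissible values. *)
Fixpoint ptime (n : nat) (p : prog) : nat :=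
  match p with
  | PSkip => 1
  | PSetW _ e => (wcost e).+1
  | PSetA _ i e => (wcost i + wcost e).+1
  | PSeq p1 p2 => ptime n p1 + ptime n p2
  | PIf b p1 p2 => (bcost b).+1 + (ptime n p1 + ptime n p2)
  | PFor x hi p1 =>
      2 + (n.+2 ^ dvar x * ((wcost hi).+3 + (ptime n p1 + 4)) + (wcost hi).+3)
  end.

Fixpoint pdeg (p : prog) : nat :=
  match p with
  | PSkip | PSetW _ _ | PSetA _ _ _ => 0
  | PSeq p1 p2 | PIf _ p1 p2 => maxn (pdeg p1) (pdeg p2)
  | PFor x _ p1 => dvar x + pdeg p1
  end.

Lemma ptime_poly p : exists C, forall n, (ptime n p <= C * n.+2 ^ pdeg p).
Proof.
have mono n d e c : (d <= e) -> (c * n.+2 ^ d <= c * n.+2 ^ e).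
  by move=> de; rewrite leq_mul2l leq_pexp2l ?orbT.
have const n d c : (c <= c * n.+2 ^ d) by rewrite leq_pmulr // expn_gt0.
elim: p => [|x e|a i e|p1 [C1 h1] p2 [C2 h2]|b p1 [C1 h1] p2 [C2 h2]|x hi p [C h]] /=.
- by exists 1 => n; rewrite expn0.
- by exists (wcost e).+1 => n; rewrite expn0 muln1.
- by exists (wcost i + wcost e).+1 => n; rewrite expn0 muln1.
- exists (C1 + C2) => n; rewrite mulnDl leq_add //.
    by apply: leq_trans (h1 n) _; apply/mono/leq_maxl.
  by apply: leq_trans (h2 n) _; apply/mono/leq_maxr.
- exists ((bcost b).+1 + (C1 + C2)) => n; rewrite !mulnDl leq_add // leq_add //.
    by apply: leq_trans (h1 n) _; apply/mono/leq_maxl.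
  by apply: leq_trans (h2 n) _; apply/mono/leq_maxr.
- exists (2 + ((wcost hi).+3 + (C + 4) + (wcost hi).+3)) => n.
  rewrite mulnDl leq_add // mulnDl leq_add // expnD mulnCA leq_mul2l.
  by apply/orP; right; rewrite !mulnDl leq_add // leq_add.
Qed.

(** * Proof rules for total correctness within a time bound *)

Section Stores.
Variables (R : realType) (n : nat).
Implicit Types m : store R.

Definition bounded m : Prop :=
  (forall x, (wvar m x < n.+2 ^ dvar x)) /\
  (forall a i, (warr m a i < n.+2 ^ darr a)).

Lemma wval_lt m e : bounded m -> (wval m e < n.+2 ^ wdeg e).
Proof.
move=> [hv ha]; elim: e => [c|x|a e _|o e1 IH1 e2 IH2] //=.
  exact: ltn_expl.
case: o => /=.
- rewrite expnS; set M := maxn _ _.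
  have h1 : (wval m e1 < n.+2 ^ M).
    by apply: leq_trans IH1 _; rewrite leq_pexp2l // leq_maxl.
  have h2 : (wval m e2 < n.+2 ^ M).
    by apply: leq_trans IH2 _; rewrite leq_pexp2l // leq_maxr.
  rewrite mulSn mulSn; move: (n.+2 ^ M) h1 h2 => P; lia.
- exact: leq_ltn_trans (leq_subr _ _) IH1.
- by rewrite expnD ltn_mul.
- exact: leq_ltn_trans (leq_div _ _) IH1.
- exact: leq_ltn_trans (leq_mod _ _) IH1.
Qed.

Variable k : nat.

Lemma wfit_bounded m e : bounded m -> (wmax e <= k) -> wfit (word_bound k n) m e.
Proof.
move=> hm.
have key e' : wdeg e' <= k -> wval m e' < word_bound k n.
  by move=> h; apply: leq_trans (wval_lt _ hm) _; rewrite leq_pexp2l.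
elim: e => [c|x|a e IH|o e1 IH1 e2 IH2] /=; rewrite geq_max => /andP[he hs].
- by rewrite (key (WConst c)).
- by rewrite (key (WVar x)).
- by rewrite (key (WArr a e)) // IH.
- move: hs; rewrite geq_max => /andP[/IH1-> /IH2->].
  by rewrite (key (WBin o e1 e2)).
Qed.

Lemma rfit_bounded m e : bounded m -> rmax e <= k -> rfit (word_bound k n) m e.
Proof.
move=> hm; elim: e => [x|a e|e|o e1 IH1 e2 IH2|e IH] //=; try exact: wfit_bounded.
by rewrite geq_max => /andP[/IH1-> /IH2->].
Qed.

Lemma bfit_bounded m b : bounded m -> bmax b <= k -> bfit (word_bound k n) m b.
Proof.
move=> hm; elim: b => [e1 e2|e1 e2|e1 e2|b IH|b1 IH1 b2 IH2] //=;
  rewrite geq_max => /andP[h1 h2]; rewrite ?wfit_bounded ?rfit_bounded //.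
by rewrite IH1 // IH2.
Qed.

(** A total-correctness assertion in the style of weakest preconditions. Absence of overflow, the
    time bound and boundedness of the store are carried along, so that proofs about programs deal
    with [Q] only. *)
Definition run p m (Q : store R -> Prop) : Prop :=
  bounded m -> exists t m', [/\ exec (word_bound k n) (compile p) m t m',
    t <= ptime n p, bounded m' & Q m'].

Lemma run_mono p m (Q Q' : store R -> Prop) :
  run p m Q -> (forall m', Q m' -> Q' m') -> run p m Q'.
Proof. by move=> h hQ /h[t [m' [? ? ? /hQ ?]]]; exists t, m'. Qed.

Lemma run_skip m (Q : store R -> Prop) : Q m -> run PSkip m Q.
Proof. by move=> hQ hm; exists 1, m; split=> //; constructor. Qed.

Lemma bounded_setw m x v : v < n.+2 ^ dvar x -> bounded m -> bounded (set_wvar m x v).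
Proof.
by move=> hv [h1 h2]; split=> //= y; rewrite /upd; case: eqP => [->|_].
Qed.

Lemma run_setw m x e (Q : store R -> Prop) : wmax e <= k ->
  wval m e < n.+2 ^ dvar x -> Q (set_wvar m x (wval m e)) -> run (PSetW x e) m Q.
Proof.
move=> he hv hQ hm; exists (wcost e).+1, (set_wvar m x (wval m e)); split=> //.
  by constructor; exact: wfit_bounded.
exact: bounded_setw.
Qed.

Lemma run_seta m a i e (Q : store R -> Prop) : wmax i <= k -> wmax e <= k ->
  wval m e < n.+2 ^ darr a -> Q (set_warr m a (wval m i) (wval m e)) ->
  run (PSetA a i e) m Q.
Proof.
move=> hi he hv hQ hm.
exists (wcost i + wcost e).+1, (set_warr m a (wval m i) (wval m e)); split=> //.
  by constructor; exact: wfit_bounded.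
case: hm => h1 h2; split=> //= b j; rewrite /upd2 /upd.
by case: eqP => [->|_] //; case: eqP.
Qed.

(** Here the degree alone bounds the new value. A counter increased in place needs [run_setw]
    instead, since its degree would grow with each increment. *)
Lemma run_setw_deg m x e (Q : store R -> Prop) : wmax e <= k -> wdeg e <= dvar x ->
  Q (set_wvar m x (wval m e)) -> run (PSetW x e) m Q.
Proof.
move=> he hd hQ hm; apply: (run_setw he _ hQ hm).
by apply: leq_trans (wval_lt e hm) _; rewrite leq_pexp2l.
Qed.

Lemma run_seta_deg m a i e (Q : store R -> Prop) : wmax i <= k -> wmax e <= k ->
  wdeg e <= darr a -> Q (set_warr m a (wval m i) (wval m e)) -> run (PSetA a i e) m Q.
Proof.
move=> hi he hd hQ hm; apply: (run_seta hi he _ hQ hm).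
by apply: leq_trans (wval_lt e hm) _; rewrite leq_pexp2l.
Qed.

Lemma run_seq p1 p2 m (Q : store R -> Prop) :
  run p1 m (fun m1 => run p2 m1 Q) -> run (PSeq p1 p2) m Q.
Proof.
move=> h /h[t1 [m1 [e1 le1 hm1 h1]]]; have [t2 [m2 [e2 le2 hm2 hQ]]] := h1 hm1.
by exists (t1 + t2), m2; split=> //; [apply: ExecSeq e1 e2|rewrite leq_add].
Qed.

Lemma run_if b p1 p2 m (Q : store R -> Prop) : bmax b <= k ->
  (bval m b -> run p1 m Q) -> (~~ bval m b -> run p2 m Q) -> run (PIf b p1 p2) m Q.
Proof.
move=> hb h1 h2 hm; have fb := bfit_bounded hm hb.
have [bm|bm] := boolP (bval m b).
  have [t [m' [e le hm' hQ]]] := h1 bm hm.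
  exists ((bcost b).+1 + t), m'; split=> //; first exact: ExecIfTrue.
  by rewrite /= leq_add2l (leq_trans le) // leq_addr.
have [t [m' [e le hm' hQ]]] := h2 bm hm.
exists ((bcost b).+1 + t), m'; split=> //; first exact: ExecIfFalse.
by rewrite /= leq_add2l (leq_trans le) // leq_addl.
Qed.

(** The bound [hi] is evaluated anew in every round, so the invariant must determine its value as
    well as the counter. The body has to give the invariant back after the increment. *)
Lemma run_for (I : nat -> store R -> Prop) h x hi p m (Q : store R -> Prop) :
  wmax hi <= k -> maxn (dvar x) 1 < k -> h < n.+2 ^ dvar x ->
  I 0 (set_wvar m x 0) ->
  (forall i m1, i <= h -> I i m1 -> wvar m1 x = i /\ wval m1 hi = h) ->
  (forall i m1, i < h -> I i m1 ->
    run p m1 (fun m2 => wvar m2 x = i /\ I i.+1 (set_wvar m2 x i.+1))) ->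
  (forall m1, I h m1 -> Q m1) ->
  run (PFor x hi p) m Q.
Proof.
move=> hhi hx hh I0 hI body hQ hm.
pose b := BWlt (WVar x) hi.
pose inc := CSetW x (WBin WAdd (WVar x) (WConst 1)).
have xk : dvar x <= k /\ 1 <= k.
  by move: hx; rewrite gtn_max => /andP[/ltnW h1 /ltnW h2].
have hb : bmax b <= k by rewrite /= !geq_max hhi leq0n (proj1 xk).
(* Induction on the number [d] of rounds left. *)
have while d i m1 : i + d = h -> I i m1 -> bounded m1 ->
    exists t m2, [/\ exec (word_bound k n) (CWhile b (CSeq (compile p) inc)) m1 t m2,
      t <= d * ((wcost hi).+3 + (ptime n p + 4)) + (wcost hi).+3,
      bounded m2 & I h m2].
  elim: d i m1 => [|d IH] i m1 ih Ii hm1; have := hI i m1.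
    rewrite addn0 in ih; rewrite ih => /(_ (leqnn _)); rewrite -{1}ih => /(_ Ii)[ex eh].
    exists (wcost hi).+3, m1; split; rewrite ?add0n // -1?ih //.
    apply: ExecWhileFalse; first exact: bfit_bounded.
    by rewrite /= ex eh ltnn.
  have lt_ih : i < h by rewrite -ih addnS ltnS leq_addr.
  move=> /(_ (ltnW lt_ih) Ii)[ex eh].
  have [t1 [m2 [e1 le1 hm2 [ex2 Ii2]]]] := body i m1 lt_ih Ii hm1.
  have hm3 : bounded (set_wvar m2 x i.+1).
    by apply: bounded_setw => //; apply: leq_ltn_trans hh.
  have [t2 [m4 [e2 le2 hm4 Ih]]] := IH i.+1 _ (etrans (addSnnS _ _) ih) Ii2 hm3.
  have e3 : exec (word_bound k n) inc m2 4 (set_wvar m2 x i.+1).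
    have -> : i.+1 = wval m2 (WBin WAdd (WVar x) (WConst 1)) by rewrite /= ex2 addn1.
    apply: ExecSetW; apply: wfit_bounded => //.
    by rewrite /= !geq_max hx !leq0n (proj1 xk) (proj2 xk).
  exists ((bcost b).+1 + (t1 + 4) + t2), m4; split=> //.
    apply: ExecWhileTrue e2; rewrite ?bfit_bounded //=; first by rewrite ex eh.
    exact: ExecSeq e1 e3.
  rewrite mulSn; move: le1 le2; rewrite /b /=; set Z := d * _.
  by clear; lia.
have hm0 : bounded (set_wvar m x 0) by apply: bounded_setw => //; rewrite expn_gt0.
have [t [m2 [e le hm2 Ih]]] := while h 0 _ (add0n h) I0 hm0.
exists (2 + t), m2; split=> //; last exact: hQ.
  by apply: ExecSeq e; constructor; rewrite wfit_bounded.
rewrite /= leq_add2l (leq_trans le) // leq_add2r leq_mul2r ltnW ?orbT //.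
Qed.

End Stores.
End Degrees.

(** * Shortest sweeps *)

Section Search.
Variables (R : realType) (n : nat) (X Y : nat -> R) (row : nat -> nat) (G : nat).
Local Open Scope nat_scope.

(** The lexicographic order in which the three nested loops of the search proceed. *)
Definition visited (m c q m' c' q' : nat) : bool :=
  (m' < m) || (m' == m) && ((c' < c) || (c' == c) && (q' < q)).

(* Invariant of the search once the transitions [q'] of the states [c'] after
   [m'] choices are processed for all [(m', c', q')] before [(m, c, q)]; then
   [f] tells whether a closed sweep is known, a shortest one having [bm]
   choices and final state [bc]. *)
Definition searching (m c q : nat) (P : nat -> nat -> nat) (f bm bc : nat) : Prop :=
  [/\ table n X Y row G P, P 0 0 != 0,
      f != 0 -> [/\ bm <= n, bm <= m, bc < states n, P bm bc != 0 &
                    allowed n X Y row G bc 0] &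
      forall m' c' q', m' <= n -> c' < states n -> q' <= n ->
        visited m c q m' c' q' -> P m' c' != 0 -> allowed n X Y row G c' q' ->
        if q' == 0 then (f != 0) && (bm <= m') else P m'.+1 (push n c' q') != 0].

(** The position may advance over entries that demand nothing: unreachable states and forbidden
    transitions. *)
Lemma searching_weaken m c q P f bm bc m2 c2 q2 :
  searching m c q P f bm bc -> m <= m2 ->
  (forall m' c' q', m' <= n -> c' < states n -> q' <= n ->
     visited m2 c2 q2 m' c' q' ->
     [|| visited m c q m' c' q', P m' c' == 0 | ~~ allowed n X Y row G c' q']) ->
  searching m2 c2 q2 P f bm bc.
Proof.
move=> [tP P0 hf hv] mm h; split=> //.
  by move/hf => [? ? ? ? ?]; split=> //; apply: leq_trans mm.
move=> m' c' q' m'n c'M q'n vis P' ha.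
by have := h _ _ _ m'n c'M q'n vis; rewrite (negbTE P') ha orbF => v; apply: hv.
Qed.

Lemma searching_reject m c q P f bm bc :
  searching m c q P f bm bc -> ~~ allowed n X Y row G c q ->
  searching m c q.+1 P f bm bc.
Proof.
move=> h na; apply: (searching_weaken h) => // m' c' q' _ _ _.
rewrite /visited; have [//|_ /=] := ltnP m' m; case: eqP => //= ->.
have [//|_ /=] := ltnP c' c; case: eqP => //= ->.
by rewrite ltnS leq_eqVlt => /orP[/eqP->|->//]; rewrite na !orbT.
Qed.

(** An earlier predecessor of the target may be overwritten, since any reachable one serves. The
    layers up to [m], to which entries of layer [m.+1] point, do not change. *)
Lemma searching_push m c q P P' f bm bc :
  searching m c q P f bm bc -> allowed n X Y row G c q -> 0 < q <= n ->
  m <= n -> c < states n -> P m c != 0 ->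
  P' m.+1 (push n c q) = c.+1 ->
  (forall a b, a <= n.+1 -> b < states n -> (a != m.+1) || (b != push n c q) ->
     P' a b = P a b) ->
  searching m c q.+1 P' f bm bc.
Proof.
move=> [[t0 tS] P0 hf hv] ha qn mn cM Pmc P'E P'F.
have M0 := states_gt0 n.
have P'm a b : a <= m -> b < states n -> P' a b = P a b.
  move=> am bM; rewrite P'F //; first exact: leq_trans am (leqW mn).
  by rewrite neq_ltn ltnS am.
have P'0 a b : a <= n.+1 -> b < states n -> P a b != 0 -> P' a b != 0.
  move=> an bM h; have [/andP[/eqP-> /eqP->]|] := boolP ((a == m.+1) && (b == push n c q)).
    by rewrite P'E.
  by rewrite negb_and => nab; rewrite P'F.
split.
- split=> [b bM|a b an bM]; first by rewrite P'm //; apply: t0.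
  have [/andP[/eqP[->] /eqP->]|] := boolP ((a.+1 == m.+1) && (b == push n c q)).
    by move=> _; exists q; rewrite P'E /=; split; rewrite // P'm.
  rewrite negb_and => nab; rewrite P'F // => /(tS a b an bM)[q' [? ? ? ? ?]].
  by exists q'; split=> //; apply: P'0; rewrite ?(leqW an).
- by rewrite P'm.
- by move=> /hf[? ? ? ? ?]; split=> //; rewrite P'm.
- move=> a b d an bM dn v; have am : a <= m.
    by move: v => /orP[/ltnW|/andP[/eqP->]].
  rewrite P'm // => h1 h2.
  have [v'|v'] := boolP (visited m c q a b d).
    have := hv a b d an bM dn v' h1 h2; case: ifP => // _; apply: P'0 => //.
    exact: push_lt.
  have [-> -> ->] : [/\ a = m, b = c & d = q].
    move: v v'; rewrite /visited; clear => v v'; split; lia.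
  by case/andP: qn => q0 _; rewrite P'E eqn0Ngt q0.
Qed.

(** Layers are processed by increasing length, so the first closed sweep found is a shortest one and
    is never replaced. *)
Lemma searching_accept m c P f bm bc :
  searching m c 0 P f bm bc -> allowed n X Y row G c 0 ->
  m <= n -> c < states n -> P m c != 0 ->
  if f == 0 then searching m c 1 P 1 m c else searching m c 1 P f bm bc.
Proof.
move=> [tP P0 hf hv] ha mn cM Pmc; have [f0|f0] := eqVneq f 0.
  split=> // a b d an bM dn v h1 h2.
  have [v'|v'] := boolP (visited m c 0 a b d).
    by have := hv a b d an bM dn v' h1 h2; rewrite f0; case: ifP.
  have [-> -> ->] : [/\ a = m, b = c & d = 0].
    by move: v v'; rewrite /visited; clear => v v'; split; lia.
  by rewrite eqxx leqnn.
split=> // a b d an bM dn v h1 h2.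
have [v'|v'] := boolP (visited m c 0 a b d); first exact: hv.
have [-> -> ->] : [/\ a = m, b = c & d = 0].
  by move: v v'; rewrite /visited; clear => v v'; split; lia.
by rewrite eqxx f0 /=; have [] := hf f0.
Qed.

Lemma searching_next m c P f bm bc :
  searching m c n.+1 P f bm bc -> searching m c.+1 0 P f bm bc.
Proof.
move=> h; apply: (searching_weaken h) => // m' c' q' _ _.
rewrite /visited; clear; lia.
Qed.

Lemma searching_skip m c P f bm bc : P m c = 0 ->
  searching m c 0 P f bm bc -> searching m c.+1 0 P f bm bc.
Proof.
move=> P0 h; apply: (searching_weaken h) => // m' c' q' _ _ _.
rewrite /visited; have [//|_ /=] := ltnP m' m; case: eqP => //= ->.
rewrite andbF orbF ltnS leq_eqVlt => /orP[/eqP->|->//].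
by rewrite P0 eqxx !orbT.
Qed.

Lemma searching_layer m P f bm bc :
  searching m (states n) 0 P f bm bc -> searching m.+1 0 0 P f bm bc.
Proof.
move=> h; apply: (searching_weaken h) => // m' c' q' _ c'M _.
rewrite /visited c'M ltnS leq_eqVlt /= !andbF orbF andbT.
by case/orP=> ->; rewrite ?orbT.
Qed.

Lemma searching_init P : P 0 0 = 1 ->
  (forall a b, a <= n.+1 -> b < states n -> (a != 0) || (b != 0) -> P a b = 0) ->
  forall bm bc, searching 0 0 0 P 0 bm bc.
Proof.
move=> P00 PF bm bc; split; rewrite ?P00 //; last first.
  by move=> a b d _ _ _; rewrite /visited !ltn0 !andbF.
split.
  by case=> // b bM; rewrite PF.
by move=> a b an bM; rewrite PF.
Qed.

Lemma opt_le : opt n X Y row G <= n.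
Proof.
rewrite -[X in _ <= X]card_ord /opt; exact: max_card.
Qed.

Hypothesis rowP : forall i k, i < n -> k <= n -> (k <= row i) = level n Y k i.

(** By induction the table reaches every prefix of the sweep given by [sweep_complete]. Its closing
    transition was therefore examined too, and the recorded length is at most its length [opt]. *)
Lemma searching_end P f bm bc : searching n.+1 0 0 P f bm bc ->
  [/\ f != 0, bm <= opt n X Y row G, bm <= n, bc < states n &
      P bm bc != 0 /\ allowed n X Y row G bc 0].
Proof.
move=> [tP P0 hf hv]; have [w [sw hw h0]] := sweep_complete X rowP G.
have wn : size w <= n by rewrite sw opt_le.
have eM i : encode n (take i w) < states n.
  apply/encode_lt/allP => q /mem_take; exact: (allP (sweep_le hw)).
have Pi i : i <= size w -> P i (encode n (take i w)) != 0.
  elim: i => [|i IH] iw; first by rewrite take0.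
  have [qn ha] := hw i iw.
  have := hv i (encode n (take i w)) (nth 0 w i).
  rewrite (leq_trans (ltnW iw) wn) eM (take_nth 0) // encode_rcons.
  case/andP: (qn) => q0 ->; rewrite /visited ltnS (leq_trans (ltnW iw) wn).
  by move=> /(_ isT isT isT isT (IH (ltnW iw)) ha); rewrite eqn0Ngt q0.
have := hv (size w) (encode n w) 0; rewrite wn -{1}(take_size w) eM /visited ltnS wn.
have := Pi _ (leqnn _); rewrite take_size => h /(_ isT isT isT isT h h0) /= /andP[f0 bw].
by have [] := hf f0; rewrite -sw.
Qed.

End Search.

(** * The algorithm *)

Definition BOr (a b : bexp) : bexp := BNot (BAnd (BNot a) (BNot b)).

Lemma bval_or (R : realType) (m : store R) a b :
  bval m (BOr a b) = bval m a || bval m b.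
Proof. by rewrite /= negb_and !negbK. Qed.

Fixpoint WPow (e : wexp) (k : nat) : wexp :=
  if k is k'.+1 then WBin WMul e (WPow e k') else WConst 1.

Lemma wval_pow (R : realType) (m : store R) e k :
  wval m (WPow e k) = (wval m e ^ k)%N.
Proof. by elim: k => //= k ->; rewrite expnS. Qed.

(* Word variables: 0 the number [n] of points; 1, 2, 3 row counters;
   4 strip; 5, 6, 7, 8 number of choices, state, next choice and tested point;
   9 test result; 10, 11, 12 [f], [bm], [bc] of the search; 13 traceback
   counter; 14, 15 sizes of the two solutions; 16 offset of the smaller one;
   17 output counter.
   Word arrays: 0 output, 1 rows, 2 tables of the strips, 3 marks. *)
Definition dvar (x : nat) : nat :=
  nth 1%N [:: 1; 1; 1; 1; 2; 1; 12; 1; 1; 1; 1; 1; 13]%N x.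
Definition darr (a : nat) : nat := nth 1%N [:: 1; 2; 13; 1]%N a.
(** A generous bound for the degrees of all expressions in the program. *)
Definition wordexp : nat := 200.

Definition base : wexp := WBin WAdd (WVar 0) (WConst 1).
Definition diff (a b : rexp) : rexp := RBin RSub a b.
Definition sqr (a : rexp) : rexp := RBin RMul a a.
Definition abscissa (i : wexp) : rexp := RArr 0 i.
Definition ordinate (i : wexp) : rexp := RArr 1 i.
Definition wpred (e : wexp) : wexp := WBin WSub e (WConst 1).
Definition rconst (c : nat) : rexp := ROfWord (WConst c).

Definition within1_exp (i j : wexp) : bexp :=
  BRle (RBin RAdd (sqr (diff (abscissa i) (abscissa j)))
                  (sqr (diff (ordinate i) (ordinate j)))) (rconst 1).

Definition reaches (i : wexp) : bexp :=
  BRle (abscissa i) (RBin RAdd (abscissa (WVar 8)) (rconst 1)).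

Definition strip_exp (i : wexp) : bexp :=
  BWeq (WBin WDiv (WBin WAdd (WArr 1 i) (WBin WMod (WVar 4) (WConst 2))) (WConst 2))
       (WBin WDiv (WVar 4) (WConst 2)).

Definition digit_exp (k : nat) : wexp :=
  WBin WMod (WBin WDiv (WVar 6) (WPow base k)) base.

Definition dominated_exp (ks : seq nat) : bexp :=
  foldr (fun k b => BOr (BAnd (BNot (BWeq (digit_exp k) (WConst 0)))
                              (within1_exp (wpred (digit_exp k)) (WVar 8))) b)
        (BWlt (WConst 0) (WConst 0)) ks.

Definition last_exp : wexp := WBin WMod (WVar 6) base.

Definition bad_exp : bexp :=
  BAnd (strip_exp (WVar 8))
  (BAnd (BOr (BWeq last_exp (WConst 0)) (reaches (wpred last_exp)))
  (BAnd (BOr (BWeq (WVar 7) (WConst 0)) (BNot (reaches (wpred (WVar 7)))))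
        (BNot (dominated_exp (iota 0 12))))).

Definition push_exp : wexp :=
  WBin WAdd (WBin WMul (WBin WMod (WVar 6) (WPow base 11)) base) (WVar 7).

(** Every strip has its own block of [n + 2] layers in one array, so no table is ever cleared. *)
Definition cell_exp (m c : wexp) : wexp :=
  WBin WAdd
    (WBin WMul
      (WBin WAdd (WBin WMul (WVar 4) (WBin WAdd (WVar 0) (WConst 2))) m)
      (WPow base 12)) c.

(** The two pairings, distinguished by the parity of the strip, use separate blocks of [n] marks. *)
Definition mark_exp (i : wexp) : wexp :=
  WBin WAdd (WBin WMul (WBin WMod (WVar 4) (WConst 2)) (WVar 0)) i.

Definition check_prog : prog :=
  PSeq (PSetW 9 (WConst 1))
       (PFor 8 (WVar 0) (PIf bad_exp (PSetW 9 (WConst 0)) PSkip)).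

Definition visit_prog : prog :=
  PSeq check_prog
    (PIf (BWeq (WVar 9) (WConst 1))
      (PIf (BWeq (WVar 7) (WConst 0))
        (PIf (BWeq (WVar 10) (WConst 0))
          (PSeq (PSetW 10 (WConst 1))
            (PSeq (PSetW 11 (WVar 5)) (PSetW 12 (WVar 6)))) PSkip)
        (PSetA 2 (cell_exp (WBin WAdd (WVar 5) (WConst 1)) push_exp)
          (WBin WAdd (WVar 6) (WConst 1))))
      PSkip).

Definition search_prog : prog :=
  PFor 5 base (PFor 6 (WPow base 12)
    (PIf (BNot (BWeq (WArr 2 (cell_exp (WVar 5) (WVar 6))) (WConst 0)))
      (PFor 7 base visit_prog) PSkip)).

Definition trace_prog : prog :=
  PFor 13 (WVar 11)
    (PSeq (PSetA 3 (mark_exp (wpred (WBin WMod (WVar 12) base))) (WConst 1))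
      (PSetW 12 (wpred (WArr 2 (cell_exp (WBin WSub (WVar 11) (WVar 13)) (WVar 12)))))).

(** The entry 1 makes the empty state reachable in layer 0. *)
Definition strip_prog : prog :=
  PSeq (PSetA 2 (cell_exp (WConst 0) (WConst 0)) (WConst 1))
    (PSeq (PSetW 10 (WConst 0)) (PSeq search_prog trace_prog)).

Definition strips_prog : prog :=
  PFor 4 (WBin WAdd (WBin WMul (WVar 0) (WConst 2)) (WConst 2)) strip_prog.

(** * Frame conditions *)

Definition agree (R : realType) (ws was : seq nat) (m m' : store R) : Prop :=
  [/\ forall x, x \notin ws -> wvar m' x = wvar m x,
      forall a, a \notin was -> warr m' a = warr m a & rarr m' = rarr m].

Section Agree.
Variables (R : realType) (ws was : seq nat).
Implicit Types m : store R.

Lemma agree_refl m : agree ws was m m. Proof. by []. Qed.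

Lemma agree_setw m m' x v : x \in ws -> agree ws was m m' ->
  agree ws was m (set_wvar m' x v).
Proof.
move=> xs [hv ha hr]; split=> //= y ys; rewrite /upd -hv //.
by case: eqP => // e; rewrite e xs in ys.
Qed.

Lemma agree_seta m m' a i v : a \in was -> agree ws was m m' ->
  agree ws was m (set_warr m' a i v).
Proof.
move=> xs [hv ha hr]; split=> //= y ys; rewrite /upd2 /upd -ha //.
by case: eqP => // e; rewrite e xs in ys.
Qed.

Lemma agree_trans ws' was' m m' m'' :
  agree ws was m m' -> agree ws' was' m' m'' ->
  all (mem ws) ws' -> all (mem was) was' -> agree ws was m m''.
Proof.
move=> [hv ha hr] [hv' ha' hr'] /allP sw /allP sa; split; last by rewrite hr'.
  by move=> x xs; rewrite hv' ?hv //; apply: contra xs => /sw.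
by move=> x xs; rewrite ha' ?ha //; apply: contra xs => /sa.
Qed.

End Agree.

Definition cell (n G m c : nat) : nat := ((G * n.+2 + m) * states n + c)%N.

(** Uniqueness of mixed-radix digits, with bases [n.+2] for the layer and [states n] for the
    state. *)
Lemma cell_inj n G m c G' m' c' : (m <= n.+1)%N -> (m' <= n.+1)%N ->
  (c < states n)%N -> (c' < states n)%N -> cell n G m c = cell n G' m' c' ->
  [/\ G = G', m = m' & c = c'].
Proof.
move=> hm hm' hc hc' e.
have e2 : (G * n.+2 + m = G' * n.+2 + m')%N.
  by have := congr1 (divn^~ (states n)) e; rewrite /= !divnMDl ?states_gt0 // !divn_small // !addn0.
split.
- by have := congr1 (divn^~ n.+2) e2; rewrite /= !divnMDl // !divn_small // !addn0.
- by have := congr1 (modn^~ n.+2) e2; rewrite /= !modnMDl !modn_small.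
- by have := congr1 (modn^~ (states n)) e; rewrite /= !modnMDl !modn_small.
Qed.

Section Specs.
Variables (R : realType) (n : nat) (X Y : nat -> R).
Implicit Types (m : store R) (Q : store R -> Prop).

Definition input_ok m : Prop := [/\ wvar m 0 = n, rarr m 0%N = X & rarr m 1%N = Y].

Lemma input_agree ws was m m' : 0%N \notin ws -> input_ok m -> agree ws was m m' ->
  input_ok m'.
Proof. by move=> h0 [h1 h2 h3] [hv _ hr]; rewrite /input_ok hv // hr. Qed.

Lemma wval_base m : wvar m 0 = n -> wval m base = n.+1.
Proof. by move=> /= ->; rewrite addn1. Qed.

Lemma wval_cell m a b : wvar m 0 = n ->
  wval m (cell_exp a b) = cell n (wvar m 4) (wval m a) (wval m b).
Proof.
move=> h; rewrite -[LHS]/((wvar m 4 * (wvar m 0 + 2) + wval m a) *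
  wval m (WPow base 12) + wval m b)%N.
by rewrite wval_pow wval_base // h addn2 /cell /states -lock.
Qed.

Lemma wval_digit m k : wvar m 0 = n ->
  wval m (digit_exp k) = digit n k (wvar m 6).
Proof.
move=> h; rewrite -[LHS]/(wvar m 6 %/ wval m (WPow base k) %% wval m base)%N.
by rewrite wval_pow wval_base.
Qed.

Lemma wval_push m : wvar m 0 = n ->
  wval m push_exp = push n (wvar m 6) (wvar m 7).
Proof.
move=> h; rewrite -[LHS]/(wvar m 6 %% wval m (WPow base 11) * wval m base + wvar m 7)%N.
by rewrite wval_pow wval_base.
Qed.

Lemma bval_within1 m i j : input_ok m ->
  bval m (within1_exp i j) = within1 X Y (wval m i) (wval m j).
Proof. by move=> [_ h1 h2]; rewrite /= h1 h2 /within1 !expr2. Qed.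

Lemma bval_bad m : input_ok m ->
  bval m bad_exp = bad n X Y (warr m 1%N) (wvar m 4) (wvar m 6) (wvar m 7) (wvar m 8).
Proof.
move=> hm; have [h0 hX hY] := hm.
have hr i : bval m (reaches i) = (X (wval m i) <= X (wvar m 8) + 1) by rewrite /= hX.
have hd ks : bval m (dominated_exp ks) = has (fun k => (digit n k (wvar m 6) != 0)%N &&
    within1 X Y (digit n k (wvar m 6) - 1)%N (wvar m 8)) ks.
  elim: ks => [//|k ks IH]; rewrite -[dominated_exp _]/(BOr
    (BAnd (BNot (BWeq (digit_exp k) (WConst 0)))
          (within1_exp (wpred (digit_exp k)) (WVar 8))) (dominated_exp ks)).
  rewrite bval_or IH [has _ (_ :: _)]/=; congr (_ || _).
  rewrite -[LHS]/((wval m (digit_exp k) != 0)%N &&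
    bval m (within1_exp (wpred (digit_exp k)) (WVar 8))) bval_within1 //.
  by rewrite -[wval m (wpred _)]/(wval m (digit_exp k) - 1)%N wval_digit.
rewrite /bad_exp /bad -hd.
rewrite -[bval m (BAnd _ _)]/([&& bval m (strip_exp (WVar 8)),
  bval m (BOr (BWeq last_exp (WConst 0)) (reaches (wpred last_exp))),
  bval m (BOr (BWeq (WVar 7) (WConst 0)) (BNot (reaches (wpred (WVar 7))))) &
  ~~ bval m (dominated_exp (iota 0 12))]).
by rewrite !bval_or hr -[bval m (BNot _)]/(~~ bval m (reaches (wpred (WVar 7)))) hr
  /= h0 addn1.
Qed.

End Specs.

(** * Correctness of the search *)

Section Runs.
Variables (R : realType) (n : nat) (X Y : nat -> R) (row : nat -> nat).
Implicit Types (m : store R) (Q : store R -> Prop).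
Local Open Scope nat_scope.

Notation run := (run dvar darr n wordexp).
Notation allowed := (allowed n X Y row).
Notation searching := (searching n X Y row).

Definition ready m : Prop := input_ok n X Y m /\ warr m 1 = row.

Definition tab (G : nat) m (a b : nat) : nat := warr m 2 (cell n G a b).

(** This keeps the tables of the strips still to come blank. *)
Definition same_elsewhere (G : nat) m m' : Prop :=
  forall G' a b, G' != G -> a <= n.+1 -> b < states n -> tab G' m' a b = tab G' m a b.

Lemma ready_agree ws was m m' : ready m ->
  agree ws was m m' -> 0 \notin ws -> 1 \notin was -> ready m'.
Proof.
by move=> [hi hr] ag h0 h1; split; [exact: input_agree ag|case: ag => _ -> //].
Qed.

Lemma check_spec m : ready m ->
  run check_prog m (fun m' => agree [:: 8; 9] [::] m m' /\
    wvar m' 9 = allowed (wvar m 4) (wvar m 6) (wvar m 7) :> nat).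
Proof.
move=> hm; apply: run_seq; apply: run_setw_deg => //.
pose nb t := ~~ bad n X Y row (wvar m 4) (wvar m 6) (wvar m 7) t.
apply: (run_for (I := fun t m1 => [/\ agree [:: 8; 9] [::] m m1, wvar m1 8 = t &
  wvar m1 9 = all nb (iota 0 t) :> nat]) (h := n)) => //.
- by split=> //; do 2!apply: agree_setw => //.
- by move=> i m1 _ [ag e8 _]; split=> //=; case: (ready_agree hm ag isT isT) => -[].
- move=> i m1 lin [ag e8 e9]; have hm1 := ready_agree hm ag isT isT.
  have eb : bval m1 bad_exp = ~~ nb i.
    rewrite (bval_bad (proj1 hm1)) e8 (proj2 hm1) /nb negbK.
    by case: ag => hv _ _; rewrite !hv.
  have iS : all nb (iota 0 i.+1) = all nb (iota 0 i) && nb i.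
    by rewrite -addn1 iotaD all_cat /= andbT.
  apply: run_if => // hb; rewrite eb in hb.
    apply: run_setw_deg => //; split; first exact: e8.
    split=> //; first by do 2!apply: agree_setw => //.
    by rewrite iS (negbTE hb) andbF.
  apply: run_skip; split; first exact: e8.
  split=> //; first by apply: agree_setw.
  by rewrite iS -(negbK (nb i)) hb andbT; exact: e9.
- by move=> m1 [ag _ e9]; split.
Qed.

Definition search_state m0 G a b q m : Prop :=
  [/\ agree [:: 5; 6; 7; 8; 9; 10; 11; 12] [:: 2] m0 m, same_elsewhere G m0 m &
      searching G a b q (tab G m) (wvar m 10) (wvar m 11) (wvar m 12)].

Section Search.
Variables (m0 : store R) (G : nat).
Hypotheses (m0_ready : ready m0) (m0G : wvar m0 4 = G).

(** The outcomes of the check correspond to [searching_reject], [searching_accept] and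
    [searching_push]. Only nonzero values are written, so the current state remains reachable. *)
Lemma visit_spec a b q m : a <= n -> b < states n -> q <= n ->
  search_state m0 G a b q m -> [/\ wvar m 5 = a, wvar m 6 = b & wvar m 7 = q] ->
  tab G m a b != 0 ->
  run visit_prog m (fun m' => [/\ search_state m0 G a b q.+1 m',
    wvar m' 5 = a, wvar m' 6 = b, wvar m' 7 = q & tab G m' a b != 0]).
Proof.
move=> an bM qn [ag ot se] [e5 e6 e7] nz.
have e4 : wvar m 4 = G by case: ag => hv _ _; rewrite hv.
have hm := ready_agree m0_ready ag isT isT.
apply: run_seq; apply: (run_mono (check_spec hm)) => m1 [ag1 e9].
have [hv1 ha1 _] := ag1.
have ag01 : agree [:: 5; 6; 7; 8; 9; 10; 11; 12] [:: 2] m0 m1.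
  exact: agree_trans ag ag1 isT isT.
have tab1 G' : tab G' m1 = tab G' m by rewrite /tab ha1.
have ot1 : same_elsewhere G m0 m1 by move=> G' c d *; rewrite tab1 ot.
have se1 : searching G a b q (tab G m1) (wvar m1 10) (wvar m1 11) (wvar m1 12).
  by rewrite tab1 !hv1.
have [[h0 _ _] _] := ready_agree m0_ready ag01 isT isT.
have k4 : wvar m1 4 = G by rewrite hv1.
have k5 : wvar m1 5 = a by rewrite hv1.
have k6 : wvar m1 6 = b by rewrite hv1.
have k7 : wvar m1 7 = q by rewrite hv1.
rewrite e4 e6 e7 in e9.
have nz1 : tab G m1 a b != 0 by rewrite tab1.
apply: run_if => //= [ok|nok]; last first.
  apply: run_skip; split=> //; split=> //; apply: searching_reject => //.
  by move: nok; rewrite e9; case: allowed.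
have ha : allowed G b q by move: ok; rewrite e9; case: allowed.
apply: run_if => //= [q0|q0].
  move: q0; rewrite k7 => /eqP q0; rewrite q0 in ha se1 k7 *.
  have se2 := searching_accept se1 ha an bM nz1.
  apply: run_if => //= f0; last first.
    by rewrite (negbTE f0) in se2; apply: run_skip; split.
  have se3 : searching G a b 1 (tab G m1) 1 (wvar m1 5) (wvar m1 6).
    by rewrite k5 k6; rewrite f0 in se2.
  do 2!(apply: run_seq; apply: run_setw_deg => //); apply: run_setw_deg => //=.
  split=> //; split=> //; do 3!apply: agree_setw => //.
have q_gt0 : 0 < q by rewrite lt0n -k7.
apply: run_seta_deg => //.
rewrite (wval_cell _ _ h0) k4 (wval_push h0) k6 k7.
have -> : wval m1 (WBin WAdd (WVar 5) (WConst 1)) = a.+1 by rewrite /= k5 addn1.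
have -> : wval m1 (WBin WAdd (WVar 6) (WConst 1)) = b.+1 by rewrite /= k6 addn1.
have pM : push n b q < states n by exact: push_lt.
set m2 := set_warr _ _ _ _.
have tab2 G' c d : c <= n.+1 -> d < states n ->
    tab G' m2 c d = if [&& G' == G, c == a.+1 & d == push n b q] then b.+1 else tab G' m1 c d.
  move=> cn dM; rewrite /tab /m2 /= /upd2 /upd /=.
  case: eqP => [/(cell_inj cn (an : a.+1 <= n.+1) dM pM)[-> -> ->]|ne].
    by rewrite !eqxx.
  case: ifP => // /and3P[/eqP e1 /eqP e2 /eqP e3]; case: ne.
  by rewrite e1 e2 e3.
have nz2 : tab G m2 a b != 0.
  rewrite tab2 ?(leqW an) //; case: ifP => //.
split=> //; split.
- exact: agree_seta.
- by move=> G' c d nG cn dM; rewrite tab2 // (negbTE nG) /= ot1.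
- apply: (searching_push se1) => //; first by rewrite q_gt0.
    by rewrite tab2 // !eqxx.
  by move=> c d cn dM; rewrite -negb_and tab2 // eqxx /= => /negbTE ->.
Qed.

Lemma state_spec a b m : a <= n -> b < states n ->
  search_state m0 G a b 0 m -> wvar m 5 = a -> wvar m 6 = b ->
  run (PIf (BNot (BWeq (WArr 2 (cell_exp (WVar 5) (WVar 6))) (WConst 0)))
        (PFor 7 base visit_prog) PSkip) m
    (fun m' => [/\ search_state m0 G a b.+1 0 m', wvar m' 5 = a & wvar m' 6 = b]).
Proof.
move=> an bM ss e5 e6; have [ag ot se] := ss.
have e4 : wvar m 4 = G by case: ag => hv _ _; rewrite hv.
have [[h0 _ _] _] := ready_agree m0_ready ag isT isT.
have eb : bval m (BNot (BWeq (WArr 2 (cell_exp (WVar 5) (WVar 6))) (WConst 0))) =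
    (tab G m a b != 0).
  rewrite -[LHS]/(warr m 2 (wval m (cell_exp (WVar 5) (WVar 6))) != 0).
  by rewrite (wval_cell _ _ h0) /= e4 e5 e6.
apply: run_if => // hb; rewrite eb in hb; last first.
  apply: run_skip; split=> //; split=> //; apply: searching_skip => //.
  by apply/eqP; rewrite negbK in hb.
apply: (run_for (I := fun q m1 => [/\ search_state m0 G a b q m1,
  wvar m1 5 = a, wvar m1 6 = b, wvar m1 7 = q & tab G m1 a b != 0]) (h := n.+1)) => //.
- by split=> //; split=> //; exact: agree_setw.
- move=> q m1 _ [[ag1 _ _] _ _ e7 _]; split=> //; apply: wval_base.
  by case: (ready_agree m0_ready ag1 isT isT) => -[].
- move=> q m1; rewrite ltnS => qn [ss1 k5 k6 k7 nz].
  apply: (run_mono (visit_spec an bM qn ss1 _ nz)) => // m2 [[ag2 ot2 se2] l5 l6 l7 nz2].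
  by split=> //; split=> //; split=> //; exact: agree_setw.
- move=> m1 [[ag1 ot1 se1] k5 k6 k7 nz]; split=> //; split=> //.
  exact: searching_next.
Qed.

Lemma search_spec m : search_state m0 G 0 0 0 m ->
  run search_prog m (fun m' => search_state m0 G n.+1 0 0 m').
Proof.
move=> ss.
have hbase m1 a b q : search_state m0 G a b q m1 -> wvar m1 0 = n.
  by move=> [ag _ _]; case: (ready_agree m0_ready ag isT isT) => -[].
apply: (run_for (I := fun a m1 => search_state m0 G a 0 0 m1 /\ wvar m1 5 = a)
  (h := n.+1)) => //.
- by case: ss => ag ot se; split=> //; split=> //; exact: agree_setw.
- by move=> a m1 _ [/hbase h e5]; split=> //; exact: wval_base.
- move=> a m1; rewrite ltnS => an [ss1 e5].
  apply: (run_for (I := fun b m2 => [/\ search_state m0 G a b 0 m2,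
    wvar m2 5 = a & wvar m2 6 = b]) (h := states n)) => //.
  + by rewrite /states -lock ltn_exp2r.
  + by case: ss1 => ag ot se; split=> //; split=> //; exact: agree_setw.
  + move=> b m2 _ [/hbase h _ e6]; split=> //.
    by rewrite wval_pow (wval_base h) /states -lock.
  + move=> b m2 bM [ss2 k5 k6].
    apply: (run_mono (state_spec an bM ss2 k5 k6)) => m3 [[ag3 ot3 se3] l5 l6].
    by split=> //; split=> //; split=> //; exact: agree_setw.
  + move=> m2 [[ag2 ot2 se2] k5 k6]; split=> //; split=> //.
    split=> //; first exact: agree_setw.
    exact: searching_layer.
- by move=> m1 [].
Qed.

End Search.

End Runs.

(** * Computing the rows, tracing back and output *)

Definition rows_prog : prog :=
  PFor 1 (WVar 0) (PFor 2 (WVar 0) (PFor 3 (WVar 0)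
    (PIf (BAnd (BNot (BWlt (WArr 1 (WVar 3)) (WVar 1)))
               (BRle (RBin RAdd (ordinate (WVar 3)) (RBin RDiv (rconst 2) (rconst 3)))
                     (ordinate (WVar 2))))
      (PSetA 1 (WVar 2) (WBin WAdd (WVar 1) (WConst 1))) PSkip))).

Definition incr_if_marked (i : wexp) (x : nat) : prog :=
  PIf (BWeq (WArr 3 i) (WConst 0)) PSkip (PSetW x (WBin WAdd (WVar x) (WConst 1))).

Definition output_prog : prog :=
  PSeq (PFor 2 (WVar 0)
    (PSeq (incr_if_marked (WVar 2) 14)
          (incr_if_marked (WBin WAdd (WVar 0) (WVar 2)) 15)))
  (PSeq (PIf (BWlt (WVar 15) (WVar 14)) (PSetW 16 (WVar 0)) (PSetW 16 (WConst 0)))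
  (PSeq (PFor 2 (WVar 0)
    (PIf (BWeq (WArr 3 (WBin WAdd (WVar 16) (WVar 2))) (WConst 0)) PSkip
      (PSeq (PSetA 0 (WVar 17) (WVar 2)) (PSetW 17 (WBin WAdd (WVar 17) (WConst 1))))))
  (PSetW 0 (WVar 17)))).

(** Bounds the number of marks by the number of choices, even when a point is chosen more than
    once. *)
Lemma count_mark (K : nat -> nat) i v N :
  (count (fun x => upd K i v x != 0) (iota 0 N) <=
   (count (fun x => K x != 0) (iota 0 N)).+1)%N.
Proof.
apply: (@leq_trans (count (predU (fun x => K x != 0%N) (pred1 i)) (iota 0 N))).
  apply: sub_count => x /=; rewrite /upd.
  by have [_ _|_] := eqVneq x i; rewrite ?orbT ?orbF.
apply: leq_trans (leq_addr (count (predI (fun x => K x != 0%N) (pred1 i)) (iota 0 N)) _) _.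
rewrite count_predUI -addn1 leq_add2l count_uniq_mem ?iota_uniq //.
by case: (_ \in _).
Qed.

Section Rounds.
Variables (R : realType) (n : nat) (X Y : nat -> R).
Implicit Types (m : store R) (Q : store R -> Prop).
Local Open Scope nat_scope.

Notation run := (run dvar darr n wordexp).

Definition marked m (i : nat) : bool := warr m 3 i != 0.

Section Strips.
Variable row : nat -> nat.
Notation ready := (ready n X Y row).

Lemma trace_spec m : ready m -> wvar m 11 <= n ->
  run trace_prog m (fun m' => [/\ agree [:: 12; 13] [:: 3] m m',
    forall x, marked m x -> marked m' x,
    forall N, count (marked m') (iota 0 N) <= count (marked m) (iota 0 N) + wvar m 11 &
    traced n (tab n (wvar m 4) m) (fun q => marked m' (wvar m 4 %% 2 * n + (q - 1)))
      (wvar m 11) (wvar m 12)]).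
Proof.
move=> hm bn; set G := wvar m 4; set bm := wvar m 11; set bc := wvar m 12.
pose K' (K : pred nat) q : Prop := K (G %% 2 * n + (q - 1)).
(* The final marks are not known during the loop, so the invariant quantifies over every [K] that
   contains the present marks: a trace of the remaining steps completes to a full trace. *)
apply: (run_for (I := fun b m1 => [/\ agree [:: 12; 13] [:: 3] m m1, wvar m1 13 = b,
    forall x, marked m x -> marked m1 x,
    forall N, count (marked m1) (iota 0 N) <= count (marked m) (iota 0 N) + b &
    forall K : pred nat, (forall x, marked m1 x -> K x) ->
      traced n (tab n G m) (K' K) (bm - b) (wvar m1 12) ->
      traced n (tab n G m) (K' K) bm bc]) (h := bm)) => //.
- by rewrite expn1 ltnS (leq_trans bn).
- split=> //.
  + exact: agree_setw.
  + by move=> N; rewrite addn0.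
  + by move=> K _; rewrite subn0.
- by move=> b m1 _ [[hv _ _] e13 _ _ _]; split=> //; rewrite /= hv.
- move=> b m1 lb [ag e13 km kc kt].
  have [[h0 _ _] _] := ready_agree hm ag isT isT.
  have [hv ha _] := ag.
  have e11 : wvar m1 11 = bm by rewrite hv.
  have e4 : wvar m1 4 = G by rewrite hv.
  apply: run_seq; apply: run_seta_deg => //.
  set i := wval m1 _; set v := wval m1 _; set m2 := set_warr _ _ _ _.
  have iE : i = G %% 2 * n + (wvar m1 12 %% n.+1 - 1) by rewrite /i /= e4 h0 addn1.
  apply: run_setw_deg => //.
  have -> : wval m2 (wpred (WArr 2 (cell_exp (WBin WSub (WVar 11) (WVar 13)) (WVar 12)))) =
      (tab n G m (bm - b) (wvar m1 12)).-1.
    rewrite -[LHS]/(warr m1 2 (wval m2 (cell_exp (WBin WSub (WVar 11) (WVar 13)) (WVar 12))) - 1).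
    by rewrite (wval_cell _ _ (h0 : wvar m2 0 = n)) subn1 ha //= e11 e13 e4.
  have sub x : marked m1 x -> marked m2 x.
    by rewrite /marked /= /upd2 /upd /=; case: (x =P i).
  split; first exact: e13.
  split=> //.
  + by do 2!apply: agree_setw => //; apply: agree_seta.
  + by move=> x /km /sub.
  + move=> N; rewrite addnS; apply: leq_trans (_ : _ <= (count (marked m1) (iota 0 N)).+1) _.
      exact: count_mark.
    by rewrite ltnS.
  + move=> K hK /= ht; apply: kt; first by move=> x /sub /hK.
    rewrite (_ : bm - b = (bm - b.+1).+1) in ht *; last by rewrite subnSK.
    split=> //; by apply: hK; rewrite -iE /marked /= /upd2 /upd /= eqxx.
- move=> m1 [ag _ km kc kt]; split=> //.
  by apply: (kt (marked m1)) => //; rewrite subnn.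
Qed.

Hypothesis rowP : forall i k, i < n -> k <= n -> (k <= row i) = level n Y k i.

(** The bound on new marks comes from [searching_end], domination from the soundness of the sweep
    that the traceback marks. *)
Lemma strip_spec m : ready m ->
  (forall a b, a <= n.+1 -> b < states n -> tab n (wvar m 4) m a b = 0) ->
  run strip_prog m (fun m' =>
    [/\ agree [:: 5; 6; 7; 8; 9; 10; 11; 12; 13] [:: 2; 3] m m',
      same_elsewhere n (wvar m 4) m m',
      forall x, marked m x -> marked m' x,
      forall N, count (marked m') (iota 0 N) <=
        count (marked m) (iota 0 N) + opt n X Y row (wvar m 4) &
      forall t, t < n -> strip row (wvar m 4) t ->
        exists2 d, d < n & marked m' (wvar m 4 %% 2 * n + d) && within1 X Y d t]).
Proof.
move=> hm fresh; set G := wvar m 4.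
have [[h0 hX hY] hr] := hm.
apply: run_seq; apply: run_seta_deg => //.
rewrite (wval_cell _ _ h0).
rewrite -[wval m (WConst 0)]/0 -[wval m (WConst 1)]/1.
set m1 := set_warr _ _ _ _.
apply: run_seq; apply: run_setw_deg => //.
rewrite -[wval m1 (WConst 0)]/0; set m2 := set_wvar _ _ _.
have hm2 : ready m2 by [].
have tab2 G' a b : a <= n.+1 -> b < states n ->
    tab n G' m2 a b = if [&& G' == G, a == 0 & b == 0] then 1 else tab n G' m a b.
  move=> an bM; rewrite /tab /m2 /= /upd2 /upd /=.
  case: eqP => [/(cell_inj an (leq0n _) bM (states_gt0 n))[-> -> ->]|ne].
    by rewrite !eqxx.
  case: ifP => // /and3P[/eqP e1 /eqP e2 /eqP e3]; case: ne.
  by rewrite e1 e2 e3.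
have ss : search_state n X Y row m2 G 0 0 0 m2.
  split=> //; apply: searching_init; first by rewrite tab2 ?states_gt0 // !eqxx.
  move=> a b an bM ab; rewrite tab2 // eqxx /= ifF ?fresh //.
  by apply/negbTE; rewrite negb_and.
apply: run_seq; apply: (run_mono (search_spec hm2 (erefl : wvar m2 4 = G) ss)).
move=> m3 [ag3 ot3 se3]; have [f0 bo bn bM [nz acc]] := searching_end rowP se3.
have hm3 := ready_agree hm2 ag3 isT isT.
have e4 : wvar m3 4 = G by case: ag3 => hv _ _; rewrite hv.
apply: (run_mono (trace_spec hm3 bn)) => m4 [ag4 km kc kt].
have [hv4 ha4 _] := ag4; have [hv3 ha3 _] := ag3.
have km3 : marked m3 = marked m by rewrite /marked ha3.
rewrite e4 in kt.
have [w [sw hw ew Kw]] :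
    exists w, [/\ size w = wvar m3 11, sweep n X Y row G w, encode n w = wvar m3 12 &
      forall q, q \in w -> marked m4 (G %% 2 * n + (q - 1))].
  by case: se3 => tP _ _ _; apply: (table_sweep tP) kt => //; exact: leqW.
split.
- apply: agree_trans (agree_trans (ws := [:: 5; 6; 7; 8; 9; 10; 11; 12; 13])
    (was := [:: 2; 3]) _ ag3 isT isT) ag4 isT isT.
  by apply: agree_setw => //; apply: agree_seta.
- move=> G' a b nG an bM'; rewrite {1}/tab ha4 // -/(tab n G' m3 a b) ot3 // tab2 //.
  by rewrite (negbTE nG).
- by move=> x; rewrite -km3; exact: km.
- by move=> N; apply: leq_trans (kc N) _; rewrite km3 leq_add2l.
- move=> t tn tG; rewrite -ew in acc.
  have [q qw qt] := sweep_sound hw acc tn tG.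
  have [i iw qE] := nthP 0 qw; have [/andP[q0 qn] _] := hw i iw.
  rewrite qE in q0 qn.
  by exists (q - 1); [rewrite subn1 prednK|rewrite Kw].
Qed.

Lemma strips_spec m : ready m -> (forall i, warr m 2 i = 0) -> (forall i, warr m 3 i = 0) ->
  run strips_prog m (fun m' =>
    [/\ agree [:: 4; 5; 6; 7; 8; 9; 10; 11; 12; 13] [:: 2; 3] m m',
      forall N, count (marked m') (iota 0 N) <=
        \sum_(0 <= G < n.*2.+2) opt n X Y row G &
      forall s t, s < 2 -> t < n ->
        exists2 d, d < n & marked m' (s * n + d) && within1 X Y d t]).
Proof.
move=> hm z2 z3.
apply: (run_for (I := fun G m1 =>
   [/\ agree [:: 4; 5; 6; 7; 8; 9; 10; 11; 12; 13] [:: 2; 3] m m1, wvar m1 4 = G,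
      forall G' a b, G <= G' -> a <= n.+1 -> b < states n -> tab n G' m1 a b = 0,
      forall N, count (marked m1) (iota 0 N) <= \sum_(0 <= G' < G) opt n X Y row G' &
      forall G' t, G' < G -> t < n -> strip row G' t ->
        exists2 d, d < n & marked m1 (G' %% 2 * n + d) && within1 X Y d t])
  (h := n.*2.+2)) => //.
- by rewrite -[dvar 4]/2 expnS expn1; clear; nia.
- split=> //; first exact: agree_setw.
    by move=> G' a b *; exact: z2.
  move=> N; rewrite big_geq // leqn0; apply/eqP.
  apply: etrans (count_pred0 (iota 0 N)); apply: eq_count => x.
  by rewrite /marked /= z3.
- move=> G m1 _ [ag e4 _ _ _]; split=> //.
  have [[h0 _ _] _] := ready_agree hm ag isT isT.
  by rewrite /= h0 muln2 addn2.
- move=> G m1 ltG [ag e4 fresh kc kd]; have hm1 := ready_agree hm ag isT isT.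
  have := strip_spec hm1; rewrite e4 => sp.
  apply: (run_mono (sp _)) => [a b an bM|m2 [ag2 ot km kc2 kd2]]; first exact: fresh.
  have ag02 := agree_trans ag ag2 isT isT.
  split; first by case: ag2 => hv _ _; rewrite hv.
  split=> //.
  + exact: agree_setw.
  + move=> G' a b ltG' an bM; rewrite -[LHS]/(tab n G' m2 a b) ot ?fresh ?(ltnW ltG') //.
    by rewrite neq_ltn ltG' orbT.
  + by move=> N; rewrite big_nat_recr //=; apply: leq_trans (kc2 N) _; rewrite leq_add2r.
  + move=> G' t; rewrite ltnS leq_eqVlt => /orP[/eqP-> tn|ltG' tn tG'].
      exact: kd2.
    have [d dn /andP[dm dt]] := kd _ _ ltG' tn tG'.
    by exists d => //; rewrite dt andbT; exact: km.
- move=> m1 [ag _ _ kc kd]; split=> // s t s2 tn.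
  have rn := row_lt rowP tn.
  (* This is the number of the strip of parity [s] that contains [t]. *)
  have := kd ((row t + s) %/ 2 * 2 + s) t; rewrite modnMDl (modn_small s2).
  apply=> //.
    by clear - rn s2; lia.
  by rewrite /strip modnMDl (modn_small s2) divnMDl // (divn_small s2) addn0.
Qed.

End Strips.

(** Round [r] raises exactly the points of height above [r]. Updating in place is harmless: a point
    raised to [r.+1] already passed the test for [r]. *)
Lemma rows_spec m : input_ok n X Y m -> (forall i, warr m 1 i = 0) ->
  run rows_prog m (fun m' => agree [:: 1; 2; 3] [:: 1] m m' /\
    forall i k, i < n -> k <= n -> (k <= warr m' 1 i) = level n Y k i).
Proof.
move=> hm z1.
have hn m1 : agree [:: 1; 2; 3] [:: 1] m m1 -> wvar m1 0 = n.
  by move=> ag; case: (input_agree (isT : 0 \notin [:: 1; 2; 3]) hm ag).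
(* [Z] is the set of points already raised in round [r]; the inner loops refine it point by point
   and then comparison by comparison. *)
pose J r (Z : nat -> bool) m1 :=
  [/\ agree [:: 1; 2; 3] [:: 1] m m1,
    forall i k, i < n -> k <= r -> (k <= warr m1 1 i) = level n Y k i &
    forall i, i < n -> (r < warr m1 1 i) = Z i /\ warr m1 1 i <= r.+1].
pose link r i j := level n Y r j && (Y j + 2 / 3 <= Y i)%R.
apply: (run_for (I := fun r m1 => J r (fun=> false) m1 /\ wvar m1 1 = r) (h := n)) => //.
- split=> //; split; first exact: agree_setw.
    by move=> i k _; rewrite leqn0 => /eqP ->.
  by move=> i _; rewrite /= z1.
- by move=> r m1 _ [[ag _ _] e1]; split=> //; exact: hn.
- move=> r m1 lr [J1 e1].
  apply: (run_for (I := fun i m2 => [/\ J r (fun i' => (i' < i) && level n Y r.+1 i') m2,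
    wvar m2 1 = r & wvar m2 2 = i]) (h := n)) => //.
  + case: J1 => ag lo hi; split=> //; split=> //; exact: agree_setw.
  + by move=> i m2 _ [[ag _ _] _ e2]; split=> //; exact: hn.
  + move=> i m2 li [J2 k1 k2].
    apply: (run_for (I := fun j m3 => [/\ J r (fun i' => (i' < i) && level n Y r.+1 i' ||
        (i' == i) && has (link r i) (iota 0 j)) m3,
      wvar m3 1 = r, wvar m3 2 = i & wvar m3 3 = j]) (h := n)) => //.
    * case: J2 => ag lo hi; split=> //; split=> //; first exact: agree_setw.
      by move=> i' /hi; rewrite /= andbF orbF.
    * by move=> j m3 _ [[ag _ _] _ _ e3]; split=> //; exact: hn.
    * move=> j m3 lj [[ag lo hi] l1 l2 l3].
      have [_ hX hY] : input_ok n X Y m3 by exact: input_agree ag.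
      have iS : has (link r i) (iota 0 j.+1) = has (link r i) (iota 0 j) || link r i j.
        by rewrite -addn1 iotaD has_cat /= orbF.
      apply: run_if => // hb; rewrite /= l1 l2 l3 hY -leqNgt lo // in hb.
        have lki : level n Y r.+1 i by apply/levelP; exists j.
        apply: run_seta_deg => //.
        have -> : wval m3 (WBin WAdd (WVar 1) (WConst 1)) = r.+1 by rewrite /= l1 addn1.
        rewrite -[wval m3 (WVar 2)]/(wvar m3 2) l2.
        split=> //; split=> //; split=> //; first by apply: agree_setw => //; apply: agree_seta.
          move=> i' k li' kr; rewrite /= /upd2 /upd /=; case: eqP => [->|_]; last exact: lo.
          by rewrite (leqW kr) (level_le (leqW kr) lki).
        move=> i' li'; rewrite iS /= /upd2 /upd /=.
        have [->|ne] := eqVneq i' i; last first.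
          by have := hi i' li'; rewrite (negbTE ne).
        by rewrite ltnSn /= (_ : link r i j) // !orbT.
      apply: run_skip; split=> //; split=> //; split=> //; first exact: agree_setw.
      move=> i' li'; rewrite iS /= (_ : link r i j = false) ?orbF; first exact: hi.
      exact: negbTE.
    * move=> m3 [[ag lo hi] l1 l2 l3]; split=> //; split=> //; split=> //.
        exact: agree_setw.
      move=> i' /hi; rewrite /= ltnS [i' <= i]leq_eqVlt.
      have -> : has (link r i) (iota 0 n) = level n Y r.+1 i by [].
      by case: eqP => [->|_]; rewrite ?ltnn ?orbF ?andbT.
  + move=> m2 [[ag lo hi] k1 k2]; split=> //; split=> //; split=> //.
    * exact: agree_setw.
    * move=> i k li; rewrite leq_eqVlt => /orP[/eqP->|]; last exact: lo.
      by have [-> _] := hi i li; rewrite li.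
    * move=> i li; have [_ h] := hi i li.
      by rewrite ltnNge h; split=> //; exact: leqW.
- by move=> m1 [[ag lo _] _]; split=> // i k li; exact: lo.
Qed.

(** Twice the smaller of the two mark counts is at most their sum. *)
Lemma output_spec m : wvar m 0 = n -> wvar m 14 = 0 -> wvar m 15 = 0 -> wvar m 17 = 0 ->
  run output_prog m (fun m' => exists s,
    [/\ s < 2,
      [seq warr m' 0 i | i <- iota 0 (wvar m' 0)] =
        [seq i <- iota 0 n | marked m (s * n + i)] &
      2 * wvar m' 0 <= count (marked m) (iota 0 n.*2)]).
Proof.
move=> h0 h14 h15 h17.
pose K s i := marked m (s * n + i).
have cS s i : count (K s) (iota 0 i.+1) = count (K s) (iota 0 i) + K s i.
  by rewrite -addn1 iotaD count_cat /= addn0.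
have cn s i : count (K s) (iota 0 i) <= i.
  by rewrite -{2}(size_iota 0 i) count_size.
apply: run_seq.
apply: (run_for (I := fun i m1 => [/\ agree [:: 2; 14; 15] [::] m m1, wvar m1 2 = i,
  wvar m1 14 = count (K 0) (iota 0 i) & wvar m1 15 = count (K 1) (iota 0 i)]) (h := n)) => //.
- by split=> //; exact: agree_setw.
- by move=> i m1 _ [[hv _ _] e2 _ _]; split=> //; rewrite /= hv.
- move=> i m1 lin [ag e2 e14 e15].
  have [hv ha _] := ag.
  have step (j : wexp) x s m2 Q : wdeg dvar darr j <= 2 -> wmax dvar darr j <= 2 ->
      dvar x = 1 -> agree [:: 2; 14; 15] [::] m m2 -> wval m2 j = s * n + i ->
      wvar m2 x = count (K s) (iota 0 i) ->
      Q (if K s i then set_wvar m2 x (count (K s) (iota 0 i.+1)) else m2) ->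
      run (incr_if_marked j x) m2 Q.
    move=> dj mj dx ag2 ej ex hQ; have [hv2 ha2 _] := ag2.
    have eK : (warr m2 3 (wval m2 j) == 0) = ~~ K s i by rewrite ej ha2 // /K /marked negbK.
    apply: run_if => [|/=|/=]; rewrite ?eK.
    + by rewrite /= !geq_max /= (leq_trans mj).
    + by move=> /negbTE h; apply: run_skip; rewrite h in hQ.
    + rewrite negbK => h; rewrite h in hQ.
      have e : wval m2 (WBin WAdd (WVar x) (WConst 1)) = count (K s) (iota 0 i.+1).
        by rewrite cS h /= ex.
      (* The counter stays below [n.+2] because it counts some of the first [i.+1] indices. *)
      apply: run_setw; rewrite ?e //; first by rewrite /= dx.
      by rewrite dx expn1 ltnS (leq_trans (cn _ _)) // (leqW lin).
  apply: run_seq; apply: (step (WVar 2) 14 0 m1) => //.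
  set m2 := if _ then _ else _.
  have ag2 : agree [:: 2; 14; 15] [::] m m2 by rewrite /m2; case: ifP => // _; exact: agree_setw.
  have k14 : wvar m2 14 = count (K 0) (iota 0 i.+1).
    by rewrite /m2 cS; case: (K _ i) => //=; rewrite addn0.
  have k2 : wvar m2 2 = i by rewrite /m2; case: ifP.
  have k15 : wvar m2 15 = count (K 1) (iota 0 i) by rewrite /m2; case: ifP.
  apply: (step (WBin WAdd (WVar 0) (WVar 2)) 15 1 m2) => //.
    by rewrite /= k2 mul1n; case: ag2 => -> // _ _; rewrite h0.
  set m3 := if _ then _ else _.
  split; first by rewrite /m3; case: ifP.
  split=> //; first by apply: agree_setw => //; rewrite /m3; case: ifP => // _; exact: agree_setw.
    by rewrite -[LHS]/(wvar m3 14) /m3; case: ifP.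
  by rewrite -[LHS]/(wvar m3 15) /m3 cS; case: (K _ i) => //=; rewrite addn0.
move=> m1 [ag _ e14 e15]; have [hv ha _] := ag.
apply: run_seq.
have sel : run (PIf (BWlt (WVar 15) (WVar 14)) (PSetW 16 (WVar 0)) (PSetW 16 (WConst 0))) m1
   (fun m2 => exists s, [/\ s < 2, agree [:: 2; 14; 15; 16] [::] m m2, wvar m2 16 = s * n &
     2 * count (K s) (iota 0 n) <= count (marked m) (iota 0 n.*2)]).
  have cnt : count (marked m) (iota 0 n.*2) = count (K 0) (iota 0 n) + count (K 1) (iota 0 n).
    rewrite -addnn iotaD count_cat add0n.
    have -> : iota n n = map (addn n) (iota 0 n) by rewrite -iotaDl addn0.
    rewrite count_map; congr (_ + _); apply: eq_count => i //=.
    by rewrite /K mul1n.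
  have ag' : agree [:: 2; 14; 15; 16] [::] m m1.
    exact: (agree_trans (agree_refl _ _ m) ag).
  apply: run_if => //= hb; rewrite e14 e15 in hb; apply: run_setw_deg => //.
    exists 1; split=> //; first exact: agree_setw.
      by rewrite mul1n /= /upd /= hv.
    by rewrite cnt mul2n -addnn leq_add2r ltnW.
  exists 0; split=> //; first exact: agree_setw.
  by rewrite cnt mul2n -addnn leq_add2l leqNgt.
apply: (run_mono sel) => m2 [s [s2 ag2 e16 hc]]; have [hv2 ha2 _] := ag2.
apply: run_seq.
apply: (run_for (I := fun i m3 => [/\ agree [:: 2; 14; 15; 16; 17] [:: 0] m m3,
  wvar m3 2 = i, wvar m3 16 = s * n, wvar m3 17 = count (K s) (iota 0 i) &
  [seq warr m3 0 j | j <- iota 0 (wvar m3 17)] = [seq j <- iota 0 i | K s j]]) (h := n)) => //.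
- split=> //=.
  + by apply: agree_setw => //; apply: (agree_trans (agree_refl _ _ m) ag2).
  + by rewrite /upd /= hv2.
  + by rewrite /upd /= hv2 // h17.
- by move=> i m3 _ [[hv3 _ _] e2 _ _ _]; split=> //; rewrite /= hv3.
- move=> i m3 lin [ag3 e2 k16 e17 eo]; have [hv3 ha3 _] := ag3.
  have fS : [seq j <- iota 0 i.+1 | K s j] =
      [seq j <- iota 0 i | K s j] ++ (if K s i then [:: i] else [::]).
    by rewrite -addn1 iotaD filter_cat.
  have eK : (warr m3 3 (wvar m3 16 + wvar m3 2) == 0) = ~~ K s i.
    by rewrite k16 e2 ha3 // /K /marked negbK.
  apply: run_if => // hK; rewrite /= eK in hK.
    apply: run_skip; split=> //; split=> //; first exact: agree_setw.
      by rewrite cS (negbTE hK) addn0.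
    by rewrite fS (negbTE hK) cats0.
  rewrite negbK in hK.
  apply: run_seq; apply: run_seta_deg => //; apply: run_setw => //.
    by rewrite expn1 /= e17 addn1 !ltnS (leq_trans (cn _ _)) // ltnW.
  split=> //; split=> //.
  + by do 2!apply: agree_setw => //; apply: agree_seta.
  + by rewrite cS hK /= /upd /= e17.
  + rewrite fS hK -eo /= /upd2 /upd /= iotaD map_cat /= add0n eqxx e2; congr (_ ++ _).
    apply/eq_in_map => j; rewrite mem_iota add0n => /andP[_ lj].
    by rewrite ltn_eqF.
- move=> m3 [ag3 e2 k16 e17 eo]; apply: run_setw_deg => //.
  exists s; split=> //.
  by rewrite -[wvar _ 0]/(wvar m3 17) e17.
Qed.

End Rounds.

(** * The approximation bound *)

Local Open Scope classical_set_scope.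

Definition main_prog : prog := PSeq rows_prog (PSeq strips_prog output_prog).

(** The loops over strips, lengths, states, next choices and tested points have degrees 2, 1, 12, 1
    and 1, hence total degree 17. For [n >= 2] the logarithm is at least [ln 2]. *)
Lemma main_time (R : realType) :
  (fun n : nat => (ptime dvar n main_prog)%:R : R) =O_\oo
    (fun n : nat => n%:R ^+ 20 * ln n%:R : R).
Proof.
have [C hC] := ptime_poly dvar main_prog.
have ln2 : 0 < ln 2 :> R by rewrite ln_gt0 // ltr1n.
(* The factor [2 ^+ 17] comes from [n + 2 <= 2 * n]; the summand 1 makes the constant positive even
   if [C] is 0. *)
apply/eqO_exP; exists (C%:R * 2 ^+ 17 / ln 2 + 1).
  by rewrite ltr_wpDl // divr_ge0 ?mulr_ge0 ?exprn_ge0 // ltW.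
near=> n.
have n2 : (2 <= n)%N by near: n; exact: nbhs_infty_ge.
have lnn : ln 2 <= ln n%:R :> R by rewrite ler_ln ?posrE ?ltr0n ?ler_nat // (leq_trans _ n2).
have pn : (n.+2 ^ 17 <= 2 ^ 17 * n ^ 20)%N.
  rewrite (_ : 20 = 17 + 3)%N // expnD mulnA -expnMn.
  apply: leq_trans (leq_pmulr _ _); last by rewrite expn_gt0 (leq_trans _ n2).
  by rewrite leq_exp2r // mul2n -addnn -addn2 leq_add2l.
have h : (ptime dvar n main_prog)%:R <= C%:R * 2 ^+ 17 * n%:R ^+ 20 :> R.
  rewrite -mulrA -!natrX -!natrM ler_nat; apply: leq_trans (hC n) _.
  by rewrite leq_mul2l -[pdeg _ _]/17%N pn orbT.
have g0 : 0 <= n%:R ^+ 20 * ln n%:R :> R.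
  by rewrite mulr_ge0 ?exprn_ge0 // (le_trans (ltW ln2)).
rewrite ger0_norm // (ger0_norm g0); apply: le_trans h _.
have A0 : 0 <= C%:R * 2 ^+ 17 :> R by rewrite mulr_ge0 ?exprn_ge0.
have B0 : 0 <= n%:R ^+ 20 :> R by rewrite exprn_ge0.
rewrite mulrDl mul1r -[leLHS]addr0 lerD // -{1}[_ * 2 ^+ 17](divfK (lt0r_neq0 ln2)).
rewrite -[leLHS]mulrA ler_wpM2l ?divr_ge0 // ?(ltW ln2) //.
by rewrite [leLHS]mulrC ler_wpM2l.
Unshelve. all: by end_near.
Qed.

Lemma edist_le1 (R : realType) (p q : plane R) :
  (Defs.edist p q <= 1) = ((p.1 - q.1) ^+ 2 + (p.2 - q.2) ^+ 2 <= 1).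
Proof. by rewrite /Defs.edist -[X in Num.sqrt _ <= X]sqrtr1 ler_sqrt. Qed.

Section Main.
Variables (R : realType) (s : seq (plane R)).
Let n := size s.
Let pt i : plane R := nth (0, 0) s i.
Let X i := (pt i).1.
Let Y i := (pt i).2.

Lemma main_spec : uniq s ->
  run dvar darr n wordexp main_prog (input_store s) (fun m =>
    exists (row : nat -> nat) (K : pred nat),
    [/\ forall i k, (i < n)%N -> (k <= n)%N -> (k <= row i)%N = level n Y k i,
      [seq warr m 0%N i | i <- iota 0 (wvar m 0%N)] = [seq i <- iota 0 n | K i],
      (2 * wvar m 0%N <= \sum_(0 <= G < n.*2.+2) opt n X Y row G)%N &
      forall t, (t < n)%N -> exists2 d, (d < n)%N & K d && within1 X Y d t]).
Proof.
move=> us; apply: run_seq.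
have h0 : input_ok n X Y (input_store s) by [].
apply: (run_mono (rows_spec h0 (fun=> erefl))) => m1 [ag1 rowP].
have [hv1 ha1 _] := ag1.
apply: run_seq.
have hm1 : ready n X Y (warr m1 1%N) m1 by split=> //; exact: input_agree ag1.
have z2 i : warr m1 2%N i = 0%N by rewrite ha1.
have z3 i : warr m1 3%N i = 0%N by rewrite ha1.
apply: (run_mono (strips_spec rowP hm1 z2 z3)) => m2 [ag2 kc kd].
have [hv2 _ _] := ag2.
have e0 : wvar m2 0%N = n by rewrite hv2 // hv1.
have e14 : wvar m2 14%N = 0%N by rewrite hv2 // hv1.
have e15 : wvar m2 15%N = 0%N by rewrite hv2 // hv1.
have e17 : wvar m2 17%N = 0%N by rewrite hv2 // hv1.
apply: (run_mono (output_spec e0 e14 e15 e17)) => m3 [b [b2 eo hc]].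
exists (warr m1 1%N), (fun i => marked m2 (b * n + i)%N); split=> //.
  exact: leq_trans hc (kc _).
by move=> t tn; exact: kd.
Qed.

End Main.

Theorem theorem4 (R : realType) :
  exists (prog : cmd) (k : nat) (T : nat -> nat),
    (fun n : nat => (T n)%:R : R) =O_\oo
      (fun n : nat => n%:R ^+ 20 * ln n%:R : R) /\
    forall (S : {fset plane R}) (s : seq (plane R)), perm_eq s S ->
      exists (t : nat) (m : store R) (S' : {fset plane R}),
        [/\ exec (word_bound k #|` S|) prog (input_store s) t m,
            (t <= T #|` S|)%N,
            outputs s m S',
            dominating_set S S' &
            forall OPT : {fset plane R}, minimum_dominating_set S OPT ->
              (#|` S'|)%:R <= 5 / 2 * (#|` OPT|)%:R :> R].
Proof.
exists (compile main_prog), wordexp, (fun n => ptime dvar n main_prog).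
split=> [|S s sS]; first exact: main_time.
have us : uniq s by rewrite (perm_uniq sS) fset_uniq.
rewrite -(perm_size sS).
have memS p : (p \in s) = (p \in S) by rewrite (perm_mem sS).
have b0 : bounded dvar darr (size s) (input_store s).
  split=> [x|a i] /=; last by rewrite expn_gt0.
  by rewrite /upd; case: eqP => [->|_]; rewrite ?expn1 ?expn_gt0 // ltnW.
have [t [m [ex le _ [row [K [rowP eo hc hd]]]]]] := main_spec us b0.
set idx := [seq warr m 0%N i | i <- iota 0 (wvar m 0%N)] in eo.
pose S' := [fset nth (0, 0) s i | i in idx]%fset.
have dist_within1 i j : (Defs.edist (nth (0, 0) s i) (nth (0, 0) s j) <= 1) =
    within1 (fun i => (nth (0, 0) s i).1) (fun i => (nth (0, 0) s i).2) i j.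
  exact: edist_le1.
exists t, m, S'; split=> //.
- split=> //.
    by apply/allP => i; rewrite -/idx eo mem_filter mem_iota => /andP[].
  by rewrite -/idx eo filter_uniq ?iota_uniq.
- split.
    apply/fsubsetP => p /imfsetP[i /=]; rewrite eo mem_filter mem_iota => /andP[_ iN] ->.
    by rewrite -memS mem_nth.
  move=> p; rewrite -memS => /(nthP (0, 0))[i iN <-].
  have [d dN /andP[Kd di]] := hd i iN; exists (nth (0, 0) s d).
    by apply/imfsetP; exists d => //=; rewrite eo mem_filter Kd mem_iota.
  by rewrite dist_within1 within1C.
- move=> O [[OS Odom] _].
  (* As [s] has no repetitions, passing to positions does not enlarge the set. *)
  pose D := [set i : 'I_(size s) | nth (0, 0) s i \in O]%SET.
  have DO : (#|D| <= #|` O|)%N.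
    rewrite cardE -(size_map (fun i : 'I_(size s) => nth (0, 0) s i)).
    apply: uniq_leq_size.
      rewrite map_inj_uniq ?enum_uniq // => i j /eqP.
      by rewrite nth_uniq // => /eqP /val_inj.
    by move=> _ /mapP[i + ->]; rewrite mem_enum inE.
  have Ddom (i : 'I_(size s)) : exists2 d, d \in D &
      within1 (fun i => (nth (0, 0) s i).1) (fun i => (nth (0, 0) s i).2) d i.
    have [|q qO qi] := Odom (nth (0, 0) s i); first by rewrite -memS mem_nth.
    have /(nthP (0, 0))[d dN dE] : q \in s by rewrite memS (fsubsetP OS).
    exists (Ordinal dN); first by rewrite inE dE.
    by rewrite within1C -dist_within1 /= dE.
  have S'm : (#|` S'| <= wvar m 0%N)%N.
    rewrite -(size_iota 0 (wvar m 0%N)) -(size_map (warr m 0%N)) -/idx.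
    rewrite -(size_map (nth (0, 0) s)); apply: uniq_leq_size; first exact: fset_uniq.
    by move=> p /imfsetP[i ii ->]; apply: map_f.
  (* Twice the size of [S'] is at most the sum of all strip optima, which is at most five times the
     size of [D]. *)
  have := sum_opt_le rowP Ddom; move: hc S'm DO.
  move: #|` S'| #|` O| #|D| (\sum_(0 <= G < _) _)%N (wvar m 0%N) => a o d c w h1 h2 h3 h4.
  have : (2 * a <= 5 * o)%N by clear - h1 h2 h3 h4; lia.
  by rewrite -(ler_nat R) !natrM; lra.
Qed.
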